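(* Let a slab occupying $[0,a]$, with density $\rho'(x,\omega)$ and compressibility $C'(x,\omega)$ (damping allowed), have a rigid backing at $x=a$ and be adjacent, in $x<0$, to a uniform acoustic medium of density $\rho$ and compressibility $C$, with sound speed $c=(C\rho)^{-1/2}$. Let $R(\omega)$ be its reflection coefficient. Then $$\int_0^\infty \operatorname{Re}\bigl(1-R(\omega)\bigr)\,\frac{d\omega}{\omega^2}=\frac{\pi a}{c}\,\frac{\langle C_0'\rangle}{C},$$ where $C_0'(x)=C'(x,0)$ is the static compressibility and $\langle f\rangle=\frac1a\int_0^a f(x)\,dx$.
   Context: Time dependence is $e^{-i\omega t}$. The constants $\rho,C,a>0$ are given; $c=(C\rho)^{-1/2}$, $z=(\rho/C)^{1/2}$, $k=\omega/c$. Slab properties: for $x\in[0,a]$ and $\operatorname{Im}\omega\ge 0$, $\rho'(x,\omega)$ and $C'(x,\omega)$ are bounded, measurable in $x$, continuous in $\omega$ on the closed upper half plane and analytic for $\operatorname{Im}\omega>0$ (causality), satisfy $\rho'(x,-\omega^* )=\rho'(x,\omega)^*$ and $C'(x,-\omega^* )=C'(x,\omega)^*$ (real-valued time-domain response), and $\operatorname{Im}(\omega\rho')\ge0$, $\operatorname{Im}(\omega C')\ge 0$ for $\operatorname{Im}\omega\ge0$ (passivity). The static values $\rho_0'(x)=\rho'(x,0)$, $C_0'(x)=C'(x,0)$ are real, positive and bounded away from zero, and $\rho'(x,\omega)=\rho_0'(x)+O(\omega)$, $C'(x,\omega)=C_0'(x)+O(\omega)$ uniformly in $x$ as $\omega\to0$.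 The undamped case is that of real positive $\rho',C'$ independent of $\omega$. Propagator: $\mathbf M(x,\omega)$ is the $2\times2$ matrix solution of $$\frac{d\mathbf M}{dx}=i\omega\,\mathbf Q\,\mathbf M,\quad \mathbf M(0,\omega)=\mathbf I,\quad \mathbf Q(x,\omega)=\begin{pmatrix}0&C'(x,\omega)\\ \rho'(x,\omega)&0\end{pmatrix},$$ which propagates the vector $(v,p)^T$ of particle velocity and pressure. Write $M_{ij}$ for the entries of $\mathbf M(a,\omega)$. Reflection coefficient: the pressure is $p=e^{ikx}+R\,e^{-ikx}$ for $x<0$, $p$ and $v$ are continuous at $x=0$, and the rigid backing imposes $v(a)=0$; equivalently $$R(\omega)=\frac{M_{11}+zM_{12}}{M_{11}-zM_{12}}.$$ *)

(* Defs.v *)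
From HB Require Import structures.
From mathcomp Require Import all_boot all_order all_algebra.
From mathcomp Require Import all_classical all_reals all_analysis.
From mathcomp Require Export complex.

Set Implicit Arguments.
Unset Strict Implicit.
Unset Printing Implicit Defensive.

Import Order.TTheory GRing.Theory Num.Theory.
Import numFieldNormedType.Exports.

Local Open Scope classical_set_scope.
Local Open Scope ring_scope.
Local Open Scope complex_scope.

(** Time dependence is exp(-i w t); the complex frequency w ranges over the
    closed upper half plane. The topology of the complex numbers is that of
    the normed field R[i]^o, whose norm takes its values in R[i]. *)

Section Acoustics.
Context {R : realType}.
Implicit Types (a x : R) (w r : R[i]).

(** Conditions shared by the density and the compressibility of the slab,
    both given as functions f of the position x in [0, a] and of w. *)
Record slab_property a (f : R -> R[i] -> R[i]) : Prop := SlabProperty {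
  slab_bounded : exists B : R, forall x w, x \in `[0, a] -> 0 <= complex.Im w ->
    `|f x w| <= B%:C ;
  slab_measurable : forall w, 0 <= complex.Im w ->
    measurable_fun `[0, a] (fun x => complex.Re (f x w)) /\
    measurable_fun `[0, a] (fun x => complex.Im (f x w)) ;
  slab_continuous : forall x, x \in `[0, a] ->
    {within [set w : R[i]^o | 0 <= complex.Im w],
      continuous (f x : R[i]^o -> R[i]^o)} ;
  (* complex differentiability: R[i]^o is a normed module over R[i] *)
  slab_analytic : forall x w, x \in `[0, a] -> 0 < complex.Im w ->
    derivable (f x : R[i]^o -> R[i]^o) w 1 ;
  slab_real_response : forall x w, x \in `[0, a] -> 0 <= complex.Im w ->
    f x (- conjc w) = conjc (f x w) ;
  slab_passive : forall x w, x \in `[0, a] -> 0 <= complex.Im w ->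
    0 <= complex.Im (w * f x w) ;
  slab_static : exists2 d : R, 0 < d & forall x, x \in `[0, a] ->
    complex.Im (f x 0) = 0 /\ d <= complex.Re (f x 0) ;
  slab_low_frequency : exists K e : R, 0 < e /\
    forall x w, x \in `[0, a] -> 0 <= complex.Im w -> `|w| <= e%:C ->
    `|f x w - f x 0| <= K%:C * `|w|
}.

Definition cintegral (D : set R) (f : R -> R[i]) : R[i] :=
  (\int[lebesgue_measure]_(x in D) complex.Re (f x)) +i*
  (\int[lebesgue_measure]_(x in D) complex.Im (f x)).

Definition Qmatrix (rho' C' : R -> R[i] -> R[i]) x w : 'M[R[i]]_2 :=
  \matrix_(i < 2, j < 2)
    if (i == 0) && (j == 1) then C' x w
    else if (i == 1) && (j == 0) then rho' x w
    else 0.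

(** Solution of dM/dx = i w Q M, M(0) = I on [0, a] at a given w. Since Q is
    only bounded and measurable in x, the equation is meant in the sense of
    Caratheodory: M is continuous and satisfies the integrated equation. *)
Definition is_propagator a (rho' C' : R -> R[i] -> R[i]) w
    (M : R -> 'M[R[i]]_2) : Prop :=
  (forall i j, {within `[0, a], continuous (fun x => M x i j : R[i]^o)}) /\
  (forall x, x \in `[0, a] ->
    M x = 1%:M + ((0 +i* 1) * w) *: \matrix_(i < 2, j < 2)
      cintegral `[0, x] (fun s => (Qmatrix rho' C' s w *m M s) i j)).

Definition sound_speed (rho C : R) : R := (Num.sqrt (C * rho))^-1.

Definition impedance (rho C : R) : R := Num.sqrt (rho / C).

(** exp(i t) for real t *)
Definition expi (t : R) : R[i] := cos t +i* sin t.

Definition exterior_pressure (k : R) r x : R[i] :=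
  expi (k * x) + r * expi (- (k * x)).

(** The velocity that goes with [exterior_pressure] by dp/dx = i w rho v,
    because k / (w rho) = 1 / z. *)
Definition exterior_velocity (z k : R) r x : R[i] :=
  (expi (k * x) - r * expi (- (k * x))) / z%:C.

(** M is the propagator at the real frequency w; p and v are the pressure and
    velocity in the slab. The exterior fields are smooth up to x = 0, so that
    continuity at the interface is equality of the one-sided values there. *)
Definition is_reflection_coefficient (rho C a w : R) (M : R -> 'M[R[i]]_2)
    r : Prop :=
  let z := impedance rho C in
  let k := w / sound_speed rho C in
  exists v p : R -> R[i],
    [/\ forall x, x \in `[0, a] ->
          v x = M x 0 0 * v 0 + M x 0 1 * p 0 /\
          p x = M x 1 0 * v 0 + M x 1 1 * p 0,
        p 0 = exterior_pressure k r 0,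
        v 0 = exterior_velocity z k r 0 &
        v a = 0].

(** The r that solves the scattering problem; 0 is only a default value, to be
    ruled out by passivity. *)
Definition reflection_coefficient (rho C a : R) (M : R -> R[i] -> 'M[R[i]]_2)
    (w : R) : R[i] :=
  xget 0 [set r | is_reflection_coefficient rho C a w (fun x => M x w%:C) r].

Definition average a (f : R -> R) : R :=
  a^-1 * \int[lebesgue_measure]_(x in `[0, a]) f x.

End Acoustics.

(* Main.v *)
Require Import Defs.
From HB Require Import structures.
From mathcomp Require Import all_boot all_order all_algebra.
From mathcomp Require Import all_classical all_reals all_analysis.
From mathcomp Require Import measurable_realfun.
From mathcomp Require Import complex.
From mathcomp Require Import ring lra.

(** The function g = 1 - R extends to a bounded holomorphic function on the
    upper half plane, continuous up to the real axis: passivity makes the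
    energy flux at x = 0 enter the slab, so that M11 - z M12 does not vanish and
    |R| <= 1. Poisson's formula at the point i y then reads
      pi Re g(i y) / y = int Re g(t) / (t^2 + y^2) dt,
    and as y tends to 0 the right-hand side increases to int Re g(t) / t^2 dt
    while g(i y) / y tends to 2 z int C'(x, 0) dx, because M(x, 0) = 1.

    Poisson's formula at w is Goursat's theorem for
    (g(s) - g(w)) / ((s - w) (s - w^* )), whose integral over the line Im s = y
    does not depend on y and vanishes as y tends to infinity. Applied to the
    coefficients of the slab, it also shows that they are Lipschitz in the
    frequency, uniformly in x; this dominates the difference quotients in
    Duhamel's formula, so that the propagator is holomorphic. *)

Import Order.TTheory GRing.Theory Num.Theory.
Import numFieldNormedType.Exports.

Local Open Scope classical_set_scope.
Local Open Scope ring_scope.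
Local Open Scope complex_scope.

Set Implicit Arguments.
Unset Strict Implicit.

(** For fixed [x] the slab is analytic in the frequency, but in [x] it is merely measurable: the
    analyticity is not given uniformly in [x], and the differential equation holds only in
    integrated form. Limits are therefore taken along sequences, where dominated convergence
    applies, and the product rule is proved for primitives. The denominator (s - w)(s - conj w)
    decays like |s|^-2, so that boundedness of g suffices at infinity; its second root lies in the
    lower half plane; and on the real axis it equals |t - w|^2, the denominator of the Poisson
    kernel. At s = w the quotient is only shown to be continuous, so the line is moved separately
    above and below Im s = y, and the two ranges are joined by continuity. The value arises as (pi /
    2) 2 z int C'(x, 0) dx: Re (1 - R) is even, so the half-line carries half of Poisson's integral,
    and z = 1 / (c C). *)

Local Notation Re := complex.Re.
Local Notation Im := complex.Im.
Local Notation nc := Normc.normc.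

(** * Real and imaginary parts, conjugation and norm of complex numbers *)

Section ComplexNorm.
Context {R : realType}.
Implicit Types z w : R[i].

Lemma ReD z w : Re (z + w) = Re z + Re w. Proof. by case: z w => [? ?] []. Qed.
Lemma ImD z w : Im (z + w) = Im z + Im w. Proof. by case: z w => [? ?] []. Qed.
Lemma ReN z : Re (- z) = - Re z. Proof. by case: z. Qed.
Lemma ImN z : Im (- z) = - Im z. Proof. by case: z. Qed.
Lemma ReM z w : Re (z * w) = Re z * Re w - Im z * Im w.
Proof. by case: z w => [? ?] []. Qed.
Lemma ImM z w : Im (z * w) = Re z * Im w + Im z * Re w.
Proof. by case: z w => [? ?] []. Qed.
Lemma ReJ z : Re (conjc z) = Re z. Proof. by case: z. Qed.
Lemma ImJ z : Im (conjc z) = - Im z. Proof. by case: z. Qed.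

Lemma complex_ext z w : Re z = Re w -> Im z = Im w -> z = w.
Proof. by case: z w => [? ?] [? ?] /= -> ->. Qed.

Lemma normcE z : `|z| = (nc z)%:C. Proof. by case: z => *; rewrite normc_def. Qed.
Lemma nc0 : nc (0 : R[i]) = 0. Proof. exact: Normc.normc0. Qed.
Lemma nc1 : nc (1 : R[i]) = 1. Proof. exact: Normc.normc1. Qed.
Lemma nc_ge0 z : 0 <= nc z. Proof. by case: z => *; exact: sqrtr_ge0. Qed.
Lemma nc_eq0 z : (nc z == 0) = (z == 0).
Proof.
by apply/eqP/eqP => [/Normc.eq0_normc|->]; rewrite ?nc0.
Qed.
Lemma nc_gt0 z : (0 < nc z) = (z != 0).
Proof. by rewrite lt_neqAle nc_ge0 andbT eq_sym nc_eq0. Qed.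
Lemma ncB z w : nc (z - w) <= nc z + nc w.
Proof. by rewrite -(normcN w); exact: le_normcD. Qed.
Lemma ncBC z w : nc (z - w) = nc (w - z).
Proof. by rewrite -normcN opprB. Qed.
Lemma nc_triB z w u : nc (z - w) <= nc (z - u) + nc (u - w).
Proof. by rewrite -{1}(subrK u z) -addrA; exact: le_normcD. Qed.
Lemma nc_subl z w : nc z - nc w <= nc (z - w).
Proof. by rewrite lerBlDr -{1}(subrK w z); exact: le_normcD. Qed.

Lemma nc_sqr z : nc z ^+ 2 = Re z ^+ 2 + Im z ^+ 2.
Proof. by case: z => a b /=; rewrite sqr_sqrtr// addr_ge0// sqr_ge0. Qed.

Lemma Re_le_nc z : `|Re z| <= nc z.
Proof.
rewrite -(@ler_sqr _ `|Re z|) ?nnegrE ?normr_ge0 ?nc_ge0// nc_sqr -normrX.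
by rewrite ger0_norm ?sqr_ge0// lerDl sqr_ge0.
Qed.
Lemma Im_le_nc z : `|Im z| <= nc z.
Proof.
rewrite -(@ler_sqr _ `|Im z|) ?nnegrE ?normr_ge0 ?nc_ge0// nc_sqr -normrX.
by rewrite ger0_norm ?sqr_ge0// lerDr sqr_ge0.
Qed.
Lemma nc_le_ReIm z : nc z <= `|Re z| + `|Im z|.
Proof.
rewrite -(@ler_sqr _ (nc z)) ?nnegrE ?addr_ge0 ?normr_ge0 ?nc_ge0// nc_sqr.
rewrite sqrrD !real_normK ?num_real//.
by have := normr_ge0 (Re z); have := normr_ge0 (Im z); nra.
Qed.

Lemma ncJ z : nc (conjc z) = nc z.
Proof. by case: z => a b /=; rewrite sqrrN. Qed.
Lemma nc_real (x : R) : nc x%:C = `|x|.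
Proof. by rewrite /= expr0n addr0 sqrtr_sqr. Qed.
Lemma nc_i : nc (0 +i* 1 : R[i]) = 1.
Proof. by rewrite /= expr0n/= expr1n add0r sqrtr1. Qed.
Lemma nc_div z w : nc (z / w) = nc z / nc w.
Proof. by rewrite Normc.normcM Normc.normcV. Qed.

Lemma mulJ z : z * conjc z = (nc z ^+ 2)%:C.
Proof. by rewrite nc_sqr; case: z => a b; apply: complex_ext => /=; ring. Qed.

Lemma invcE z : z^-1 = conjc z * ((nc z ^+ 2)^-1)%:C.
Proof.
have [->|z0] := eqVneq z 0; first by rewrite invr0 conjc0 mul0r.
apply: (mulfI z0); rewrite mulfV// mulrA mulJ -rmorphM/= mulfV//.
by rewrite expf_neq0// nc_eq0.
Qed.

End ComplexNorm.

(** * Convergence of complex sequences *)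

Section ComplexSequences.
Context {R : realType}.
Implicit Types (u v : nat -> R[i]) (l z w : R[i]).

(** Convergence by components is the form that real dominated convergence delivers; [ccvg_nc0] and
    [nc0_ccvg] relate it to convergence in norm. *)
Definition ccvg u l :=
  ((fun n => Re (u n)) @ \oo --> Re l) /\ ((fun n => Im (u n)) @ \oo --> Im l).

Lemma ccvg_cst l : ccvg (fun=> l) l.
Proof. by split; exact: cvg_cst. Qed.

Lemma ccvgD u v l w : ccvg u l -> ccvg v w -> ccvg (fun n => u n + v n) (l + w).
Proof.
move=> [ur ui] [vr vi]; split.
  by under eq_fun do rewrite ReD; rewrite ReD; exact: cvgD.
by under eq_fun do rewrite ImD; rewrite ImD; exact: cvgD.
Qed.

Lemma ccvgN u l : ccvg u l -> ccvg (fun n => - u n) (- l).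
Proof.
move=> [ur ui]; split.
  by under eq_fun do rewrite ReN; rewrite ReN; exact: cvgN.
by under eq_fun do rewrite ImN; rewrite ImN; exact: cvgN.
Qed.

Lemma ccvgB u v l w : ccvg u l -> ccvg v w -> ccvg (fun n => u n - v n) (l - w).
Proof. by move=> ul vw; apply: ccvgD => //; exact: ccvgN. Qed.

Lemma ccvgM u v l w : ccvg u l -> ccvg v w -> ccvg (fun n => u n * v n) (l * w).
Proof.
move=> [ur ui] [vr vi]; split.
  by under eq_fun do rewrite ReM; rewrite ReM; apply: cvgB; exact: cvgM.
by under eq_fun do rewrite ImM; rewrite ImM; apply: cvgD; exact: cvgM.
Qed.

Lemma ccvgJ u l : ccvg u l -> ccvg (fun n => conjc (u n)) (conjc l).
Proof.
move=> [ur ui]; split.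
  by under eq_fun do rewrite ReJ; rewrite ReJ.
by under eq_fun do rewrite ImJ; rewrite ImJ; exact: cvgN.
Qed.

Lemma ccvg_real (u : nat -> R) (l : R) :
  u @ \oo --> l -> ccvg (fun n => (u n)%:C) l%:C.
Proof. by move=> ul; split => //=; exact: cvg_cst. Qed.

Lemma ccvg_nc0 u l : ccvg u l -> (fun n => nc (u n - l)) @ \oo --> 0.
Proof.
move=> [ur ui].
apply: (@squeeze_cvgr _ _ _ _ (fun=> 0) (fun n => `|Re (u n - l)| + `|Im (u n - l)|)).
- by apply: nearW => n; rewrite nc_ge0 nc_le_ReIm.
- exact: cvg_cst.
- rewrite -[X in _ --> X](addr0 0) -[in X in X + _](normr0 R) -[in X in _ + X](normr0 R).
  apply: cvgD; apply: cvg_norm.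
    under eq_fun do rewrite ReD ReN; rewrite -(subrr (Re l)).
    by apply: cvgB => //; exact: cvg_cst.
  under eq_fun do rewrite ImD ImN; rewrite -(subrr (Im l)).
  by apply: cvgB => //; exact: cvg_cst.
Qed.

Lemma nc0_ccvg u l : (fun n => nc (u n - l)) @ \oo --> 0 -> ccvg u l.
Proof.
move=> u0; split.
  apply/cvgrPdist_le => e e0; move/cvgrPdist_le : u0 => /(_ _ e0).
  apply: filterS => n; rewrite sub0r normrN ger0_norm ?nc_ge0//.
  by apply: le_trans; rewrite -ReN -ReD ncBC; exact: Re_le_nc.
apply/cvgrPdist_le => e e0; move/cvgrPdist_le : u0 => /(_ _ e0).
apply: filterS => n; rewrite sub0r normrN ger0_norm ?nc_ge0//.
by apply: le_trans; rewrite -ImN -ImD ncBC; exact: Im_le_nc.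
Qed.

Lemma squeeze_ccvg u l (e : nat -> R) : (forall n, nc (u n - l) <= e n) ->
  e @ \oo --> 0 -> ccvg u l.
Proof.
move=> ue e0; apply: nc0_ccvg.
apply: (@squeeze_cvgr _ _ _ _ (fun=> 0) e) => //; last exact: cvg_cst.
by apply: nearW => n; rewrite nc_ge0 ue.
Qed.

Lemma ccvg_nc u l : ccvg u l -> (fun n => nc (u n)) @ \oo --> nc l.
Proof.
move=> ul; have u0 := ccvg_nc0 ul; apply/cvgrPdist_le => e e0.
move/cvgrPdist_le : u0 => /(_ _ e0); apply: filterS => n.
rewrite sub0r normrN ger0_norm ?nc_ge0//; apply: le_trans.
by have := nc_subl (u n) l; have := nc_subl l (u n); rewrite ncBC ler_norml => ? ?; apply/andP; split; lra.
Qed.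

Lemma ccvgV u l : l != 0 -> ccvg u l -> ccvg (fun n => (u n)^-1) l^-1.
Proof.
move=> l0 ul; rewrite invcE.
rewrite (_ : (fun _ => _) = fun n => conjc (u n) * ((nc (u n) ^+ 2)^-1)%:C); last first.
  by apply/funext => n; rewrite invcE.
apply: ccvgM; first exact: ccvgJ.
apply: ccvg_real; apply: cvgV; first by rewrite expf_neq0// nc_eq0.
under eq_fun do rewrite expr2; rewrite expr2.
by apply: cvgM; exact: ccvg_nc.
Qed.

Lemma ccvg_uniq u l w : ccvg u l -> ccvg u w -> l = w.
Proof.
by move=> [ur ui] [vr vi]; apply: complex_ext;
  [exact: (cvg_unique _ ur vr)|exact: (cvg_unique _ ui vi)].
Qed.

Lemma ccvg_eps u l : ccvg u l -> forall e, 0 < e -> \forall n \near \oo, nc (u n - l) < e.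
Proof.
move=> /ccvg_nc0 /cvgrPdist_lt h e /h; apply: filterS => n.
by rewrite sub0r normrN ger0_norm// nc_ge0.
Qed.

Lemma eps_ccvg u l :
  (forall e, 0 < e -> \forall n \near \oo, nc (u n - l) <= e) -> ccvg u l.
Proof.
move=> h; apply: nc0_ccvg; apply/cvgrPdist_le => e /h; apply: filterS => n.
by rewrite sub0r normrN ger0_norm// nc_ge0.
Qed.

Lemma ccvg_near u v l : (\forall n \near \oo, u n = v n) -> ccvg u l -> ccvg v l.
Proof.
move=> uv ul; apply: eps_ccvg => e e0.
apply: filterS2 (ccvg_eps ul e0) uv => n + <-; exact: ltW.
Qed.

End ComplexSequences.

(** Since the data are only known in the upper half plane, difference quotients
    at [w] are taken along increments small enough to stay inside it. *)
Definition cderiv {R : realType} (f : R[i] -> R[i]) (w d : R[i]) :=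
  forall h : nat -> R[i], (forall n, h n != 0) -> (forall n, 2 * nc (h n) <= Im w) ->
    ccvg h 0 -> ccvg (fun n => (f (w + h n) - f w) / h n) d.

(** * Rules for complex derivatives along sequences *)

Section ComplexDerivative.
Context {R : realType}.
Implicit Types (f g : R[i] -> R[i]) (w d : R[i]).

(** Goursat's theorem needs a uniform error in a disc. If no radius worked, bad increments of norm
    below 1/(n + 1) would form a sequence admissible in [cderiv]; they are nonzero because the error
    vanishes at [h = 0]. *)
Lemma cderiv_eps f w d : 0 < Im w -> cderiv f w d ->
  forall e, 0 < e -> exists2 r, 0 < r &
    forall h, nc h < r -> nc (f (w + h) - f w - d * h) <= e * nc h.
Proof.
move=> w0 fd e e0; apply: contrapT => nex.
have H n : exists h, [/\ nc h < n.+1%:R^-1, 2 * nc h <= Im w &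
    e * nc h < nc (f (w + h) - f w - d * h)].
  apply: contrapT => nh; apply: nex; exists (Num.min n.+1%:R^-1 (Im w / 2)).
    by rewrite lt_min invr_gt0 ltr0n/= divr_gt0.
  move=> h; rewrite lt_min => /andP[h1 h2]; rewrite leNgt; apply/negP => h3.
  by apply: nh; exists h; split => //; lra.
have [h hP] := choice H.
have h_neq0 n : h n != 0.
  apply/eqP => h0; have [_ _] := hP n.
  by rewrite h0 addr0 subrr mulr0 subr0 nc0 mulr0 ltxx.
have h0 : ccvg h 0.
  apply: (@squeeze_ccvg _ _ _ (fun n => n.+1%:R^-1)); last exact: cvg_harmonic.
  by move=> n; rewrite subr0; have [/ltW] := hP n.
have hw n : 2 * nc (h n) <= Im w by have [] := hP n.
have /ccvg_eps/(_ _ e0) [N _ /(_ _ (leqnn N))/=] := fd h h_neq0 hw h0.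
apply/negP; rewrite -leNgt.
have [_ _ /ltW] := hP N.
rewrite -[X in _ -> _ <= nc X](mulfK (h_neq0 N)) nc_div ler_pdivlMr ?nc_gt0//.
by rewrite mulrBl divfK.
Qed.

Lemma cderiv_lip f w d : 0 < Im w -> cderiv f w d -> exists2 r, 0 < r &
  forall h, nc h < r -> nc (f (w + h) - f w) <= (nc d + 1) * nc h.
Proof.
move=> w0 fd; have [r r0 rP] := cderiv_eps w0 fd ltr01; exists r => // h /rP.
rewrite mul1r mulrDl mul1r -Normc.normcM => H.
by have := nc_subl (f (w + h) - f w) (d * h); lra.
Qed.

Lemma cderiv_ccvg f w d : 0 < Im w -> cderiv f w d ->
  forall u, ccvg u w -> ccvg (f \o u) (f w).
Proof.
move=> w0 /(cderiv_lip w0)[r r0 rP] u uw; apply: eps_ccvg => e e0.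
have d0 : 0 < nc d + 1 by rewrite ltr_wpDl// nc_ge0.
have := ccvg_eps uw r0; have : 0 < e / (nc d + 1) by rewrite divr_gt0.
move=> /(ccvg_eps uw); apply: filterS2 => n ue /rP; rewrite subrKC => /le_trans.
by apply; rewrite -ler_pdivlMl// mulrC ltW.
Qed.

Lemma cderiv_cst c w : cderiv (fun=> c) w 0.
Proof.
move=> h h0 hw hc; rewrite (_ : (fun _ => _) = fun=> 0); first exact: ccvg_cst.
by apply/funext => n; rewrite subrr mul0r.
Qed.

Lemma cderiv_id w : cderiv id w 1.
Proof.
move=> h h0 hw hc; rewrite (_ : (fun _ => _) = fun=> 1); first exact: ccvg_cst.
by apply/funext => n; rewrite addrC addKr mulfV.
Qed.

Lemma cderivD f g w d e : cderiv f w d -> cderiv g w e ->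
  cderiv (fun s => f s + g s) w (d + e).
Proof.
move=> fd ge h h0 hw hc.
rewrite (_ : (fun _ => _) = fun n => (f (w + h n) - f w) / h n + (g (w + h n) - g w) / h n).
  by apply: ccvgD; [exact: fd|exact: ge].
by apply/funext => n; field.
Qed.

Lemma cderivM f g w d e : 0 < Im w -> cderiv f w d -> cderiv g w e ->
  cderiv (fun s => f s * g s) w (d * g w + f w * e).
Proof.
move=> w0 fd ge h h0 hw hc.
rewrite (_ : (fun _ => _) = fun n =>
    (f (w + h n) - f w) / h n * g (w + h n) + f w * ((g (w + h n) - g w) / h n)).
  apply: ccvgD; apply: ccvgM; [exact: fd| |exact: ccvg_cst|exact: ge].
  apply: (cderiv_ccvg w0 ge (u := fun n => w + h n)).
  by rewrite -[X in ccvg _ X]addr0; apply: ccvgD => //; exact: ccvg_cst.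
by apply/funext => n; field.
Qed.

Lemma cderivN f w d : cderiv f w d -> cderiv (fun s => - f s) w (- d).
Proof.
move=> fd h h0 hw hc.
rewrite (_ : (fun _ => _) = fun n => - ((f (w + h n) - f w) / h n)).
  by apply: ccvgN; exact: fd.
by apply/funext => n; field.
Qed.

Lemma cderivB f g w d e : cderiv f w d -> cderiv g w e ->
  cderiv (fun s => f s - g s) w (d - e).
Proof. by move=> fd /cderivN; exact: cderivD. Qed.

Lemma cderivV f w d : 0 < Im w -> f w != 0 -> cderiv f w d ->
  cderiv (fun s => (f s)^-1) w (- d / f w ^+ 2).
Proof.
move=> w0 fw fd h h0 hw hc.
have fc : ccvg (fun n => f (w + h n)) (f w).
  apply: (cderiv_ccvg w0 fd (u := fun n => w + h n)).
  by rewrite -[X in ccvg _ X]addr0; apply: ccvgD => //; exact: ccvg_cst.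
(* [f (w + h n)] is known to be nonzero only eventually, so the quotient is rewritten for large
   [n]. *)
apply: (@ccvg_near _ (fun n => - ((f (w + h n) - f w) / h n) / (f (w + h n) * f w))).
  have fw0 : 0 < nc (f w) by rewrite nc_gt0.
  have := ccvg_eps fc fw0; apply: filterS => n fn.
  have fn0 : f (w + h n) != 0.
    by apply: contraTneq fn => ->; rewrite sub0r normcN ltxx.
  by field; rewrite fn0 fw h0.
apply: ccvgM; first by apply: ccvgN; exact: fd.
apply: ccvgV; first by rewrite sqrf_eq0.
by apply: ccvgM => //; exact: ccvg_cst.
Qed.

End ComplexDerivative.

(** * Integrals of complex-valued functions of a real variable *)

Section ComplexIntegral.
Context {R : realType}.
Local Notation mu := (@lebesgue_measure R).
Implicit Types (D : set R) (f g : R -> R[i]) (a b c x t : R) (z : R[i]).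

Definition cmeasurable D f :=
  measurable_fun D (fun x => Re (f x)) /\ measurable_fun D (fun x => Im (f x)).

Definition cintegrable D f :=
  mu.-integrable D (EFin \o (fun x => Re (f x))) /\
  mu.-integrable D (EFin \o (fun x => Im (f x))).

Lemma cmeasurable_cst D z : cmeasurable D (fun=> z).
Proof. by split; exact: measurable_cst. Qed.

Lemma cmeasurableD D f g : cmeasurable D f -> cmeasurable D g ->
  cmeasurable D (fun x => f x + g x).
Proof.
move=> [fr fi] [gr gi]; split.
  by under eq_fun do rewrite ReD; exact: measurable_funD.
by under eq_fun do rewrite ImD; exact: measurable_funD.
Qed.

Lemma cmeasurableM D f g : cmeasurable D f -> cmeasurable D g ->
  cmeasurable D (fun x => f x * g x).
Proof.
move=> [fr fi] [gr gi]; split.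
  by under eq_fun do rewrite ReM; apply: measurable_funB; exact: measurable_funM.
by under eq_fun do rewrite ImM; apply: measurable_funD; exact: measurable_funM.
Qed.

Lemma cmeasurableN D f : cmeasurable D f -> cmeasurable D (fun x => - f x).
Proof.
move=> fm; rewrite (_ : (fun _ => _) = fun x => (-1) * f x).
  by apply: cmeasurableM => //; exact: cmeasurable_cst.
by apply/funext => x; rewrite mulN1r.
Qed.

Lemma cmeasurableB D f g : cmeasurable D f -> cmeasurable D g ->
  cmeasurable D (fun x => f x - g x).
Proof. by move=> fm gm; apply: cmeasurableD => //; exact: cmeasurableN. Qed.

Lemma cmeasurableJ D f : cmeasurable D f -> cmeasurable D (fun x => conjc (f x)).
Proof.
move=> [fr fi]; split; first by under eq_fun do rewrite ReJ.
under eq_fun do rewrite ImJ.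
exact: measurableT_comp.
Qed.

Lemma cmeasurable_real D (f : R -> R) :
  measurable_fun D f -> cmeasurable D (fun x => (f x)%:C).
Proof. by split => //=; exact: measurable_cst. Qed.

Lemma cmeasurableS (E D : set R) f : measurable E -> D `<=` E ->
  cmeasurable E f -> cmeasurable D f.
Proof. by move=> mE DE [fr fi]; split; exact: measurable_funS fr || exact: measurable_funS fi. Qed.

Lemma cmeasurable_ccvg D (h : nat -> R -> R[i]) f :
  (forall n, cmeasurable D (h n)) -> (forall x, D x -> ccvg (h^~ x) (f x)) ->
  cmeasurable D f.
Proof.
move=> hm hf; split.
  apply: (@measurable_fun_cvg _ _ _ _ (fun n x => Re (h n x))) => [n|x Dx].
    by have [] := hm n.
  by have [] := hf x Dx.
apply: (@measurable_fun_cvg _ _ _ _ (fun n x => Im (h n x))) => [n|x Dx].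
  by have [] := hm n.
by have [] := hf x Dx.
Qed.

Lemma dominated_cintegrable D f (k : R -> R) : measurable D -> cmeasurable D f ->
  mu.-integrable D (EFin \o k) -> (forall x, D x -> nc (f x) <= k x) ->
  cintegrable D f.
Proof.
move=> mD [fr fi] ik fk; split.
  apply: le_integrable ik => //; first exact/measurable_EFinP.
  move=> x Dx /=; rewrite lee_fin (le_trans (Re_le_nc _))// (le_trans (fk _ Dx))//.
  exact: ler_norm.
apply: le_integrable ik => //; first exact/measurable_EFinP.
move=> x Dx /=; rewrite lee_fin (le_trans (Im_le_nc _))// (le_trans (fk _ Dx))//.
exact: ler_norm.
Qed.

Lemma integrable_cst_itv a b (K : R) : mu.-integrable `[a, b] (EFin \o (fun=> K)).
Proof.
apply: measurable_bounded_integrable => //.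
  by rewrite /= lebesgue_measure_itv/=; case: ifPn => _; rewrite ?ltry.
exists `|K|; split; first exact: num_real.
by move=> M KM x _; apply/ltW.
Qed.

Lemma bounded_cintegrable a b f (K : R) : cmeasurable `[a, b] f ->
  (forall x, `[a, b]%classic x -> nc (f x) <= K) -> cintegrable `[a, b] f.
Proof.
move=> fm fK; apply: (@dominated_cintegrable _ _ (fun=> K)) => //.
exact: integrable_cst_itv.
Qed.

Lemma cintegrable_measurable D f : cintegrable D f -> cmeasurable D f.
Proof.
by move=> [fr fi]; split; apply/measurable_EFinP;
  [exact: measurable_int fr|exact: measurable_int fi].
Qed.

Lemma cintegrableD D f g : measurable D -> cintegrable D f -> cintegrable D g ->
  cintegrable D (fun x => f x + g x).
Proof.
move=> mD [fr fi] [gr gi]; split.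
  under [X in _ \o X]eq_fun do rewrite ReD.
  exact: (integrableD _ fr gr).
under [X in _ \o X]eq_fun do rewrite ImD.
exact: (integrableD _ fi gi).
Qed.

Lemma cintegrableZl D f z : measurable D -> cintegrable D f ->
  cintegrable D (fun x => z * f x).
Proof.
move=> mD [fr fi]; split.
  under [X in _ \o X]eq_fun do rewrite ReM.
  exact: (integrableB _ (integrableZl _ (Re z) fr) (integrableZl _ (Im z) fi)).
under [X in _ \o X]eq_fun do rewrite ImM.
exact: (integrableD _ (integrableZl _ (Re z) fi) (integrableZl _ (Im z) fr)).
Qed.

Lemma cintegrableN D f : measurable D -> cintegrable D f ->
  cintegrable D (fun x => - f x).
Proof.
move=> mD fi; rewrite (_ : (fun _ => _) = fun x => (-1) * f x).
  exact: cintegrableZl.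
by apply/funext => x; rewrite mulN1r.
Qed.

Lemma cintegrableB D f g : measurable D -> cintegrable D f -> cintegrable D g ->
  cintegrable D (fun x => f x - g x).
Proof. by move=> mD fm gm; apply: cintegrableD => //; exact: cintegrableN. Qed.

Lemma eq_cintegral D f g : (forall x, D x -> f x = g x) ->
  cintegral D f = cintegral D g.
Proof.
by move=> fg; congr (_ +i* _); apply: eq_Rintegral => x; rewrite inE => Dx; rewrite fg.
Qed.

Lemma cintegralD D f g : measurable D -> cintegrable D f -> cintegrable D g ->
  cintegral D (fun x => f x + g x) = cintegral D f + cintegral D g.
Proof.
move=> mD [fr fi] [gr gi]; apply: complex_ext => /=.
  by rewrite -RintegralD//; apply: eq_Rintegral => x _; rewrite ReD.
by rewrite -RintegralD//; apply: eq_Rintegral => x _; rewrite ImD.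
Qed.

Lemma cintegralZl D f z : measurable D -> cintegrable D f ->
  cintegral D (fun x => z * f x) = z * cintegral D f.
Proof.
move=> mD [fr fi]; apply: complex_ext; rewrite ?ReM ?ImM /=.
  rewrite -!RintegralZl// -RintegralB//; first by apply: eq_Rintegral => x _; rewrite ReM.
    exact: (integrableZl _ (Re z) fr).
  exact: (integrableZl _ (Im z) fi).
rewrite -!RintegralZl// -RintegralD//; first by apply: eq_Rintegral => x _; rewrite ImM.
  exact: (integrableZl _ (Re z) fi).
exact: (integrableZl _ (Im z) fr).
Qed.

Lemma cintegralB D f g : measurable D -> cintegrable D f -> cintegrable D g ->
  cintegral D (fun x => f x - g x) = cintegral D f - cintegral D g.
Proof.
move=> mD fi gi; rewrite cintegralD//; last exact: cintegrableN.
congr (_ + _); rewrite -mulN1r -cintegralZl//.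
by apply: eq_cintegral => x _; rewrite mulN1r.
Qed.

Lemma cintegralJ D f : measurable D -> cintegrable D f ->
  cintegral D (fun x => conjc (f x)) = conjc (cintegral D f).
Proof.
move=> mD [fr fi]; apply: complex_ext; rewrite ?ReJ ?ImJ /=.
  by apply: eq_Rintegral => x _; rewrite ReJ.
rewrite -mulN1r -RintegralZl//.
by apply: eq_Rintegral => x _; rewrite ImJ mulN1r.
Qed.

Lemma cintegral_cst a b z : a <= b -> cintegral `[a, b] (fun=> z) = z * (b - a)%:C.
Proof.
move=> ab; apply: complex_ext; rewrite ?ReM ?ImM /= !Rintegral_cst//=;
  rewrite lebesgue_measure_itv/= lte_fin.
  have [|ba] := ltP a b; rewrite -?EFinB/= ?mulr0 ?subr0//.
  by rewrite (@le_anti _ _ a b) ?ab// subrr mulr0.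
have [|ba] := ltP a b; rewrite -?EFinB/= ?mulr0 ?add0r//.
by rewrite (@le_anti _ _ a b) ?ab// subrr mulr0.
Qed.

(* the factor 2 comes from bounding the real and the imaginary part separately *)
Lemma nc_cintegral_le D f (k : R -> R) : measurable D -> cmeasurable D f ->
  mu.-integrable D (EFin \o k) -> (forall x, D x -> nc (f x) <= k x) ->
  nc (cintegral D f) <= 2 * \int[mu]_(x in D) k x.
Proof.
move=> mD fm ik fk; have [fr fi] := dominated_cintegrable mD fm ik fk.
apply: le_trans (nc_le_ReIm _) _; rewrite mulr_natl mulr2n /=; apply: lerD.
  apply: le_trans (le_normr_Rintegral _ fr) _ => //.
  apply: le_Rintegral => //; first exact: (integrable_norm fr).
  by move=> x Dx; apply: le_trans (Re_le_nc _) (fk _ Dx).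
apply: le_trans (le_normr_Rintegral _ fi) _ => //.
apply: le_Rintegral => //; first exact: (integrable_norm fi).
by move=> x Dx; apply: le_trans (Im_le_nc _) (fk _ Dx).
Qed.

Lemma nc_cintegral_itv a b f (K : R) : a <= b -> cmeasurable `[a, b] f ->
  (forall x, `[a, b]%classic x -> nc (f x) <= K) ->
  nc (cintegral `[a, b] f) <= 2 * K * (b - a).
Proof.
move=> ab fm fK.
have := @nc_cintegral_le _ _ (fun=> K) _ fm (integrable_cst_itv _ _ _) fK.
move=> /(_ (measurable_itv _)) /le_trans; apply.
rewrite Rintegral_cst//= lebesgue_measure_itv/= lte_fin mulrA.
have [|ba] := ltP a b; rewrite -?EFinB//=.
by rewrite (@le_anti _ _ a b) ?ab// subrr mulr0.
Qed.

Lemma cintegral_itv_split a b c f : a <= b -> b <= c -> cintegrable `[a, c] f ->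
  cintegral `[a, c] f = cintegral `[a, b] f + cintegral `[b, c] f.
Proof.
move=> ab bc [fr fi].
have H (h : R -> R) : mu.-integrable `[a, c] (EFin \o h) ->
    \int[mu]_(x in `[a, c]) h x =
    \int[mu]_(x in `[a, b]) h x + \int[mu]_(x in `[b, c]) h x.
  move=> ih; rewrite -(@Rintegral_itv_obnd_cbnd _ b (BRight c)).
    by rewrite -(@Rintegral_itvB _ h (BLeft a) (BRight c) b)// subrKC.
  apply: integrableS ih => //.
  by apply: subset_itv; rewrite bnd_simp.
by apply: complex_ext; rewrite ?ReD ?ImD/= H.
Qed.

Lemma cintegral_point a f : cintegral `[a, a] f = 0.
Proof. by rewrite /cintegral set_itv1 !Rintegral_set1. Qed.

(** Measurability of [f] is deduced, not assumed: some integrands are known only as limits, on the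
    real axis or on the line through a removable singularity. *)
Lemma cintegral_ccvg D (h : nat -> R -> R[i]) f (k : R -> R) : measurable D ->
  (forall n, cmeasurable D (h n)) -> (forall x, D x -> ccvg (h^~ x) (f x)) ->
  mu.-integrable D (EFin \o k) -> (forall n x, D x -> nc (h n x) <= k x) ->
  ccvg (fun n => cintegral D (h n)) (cintegral D f).
Proof.
move=> mD hm hf ik hk; have [fr fi] := cmeasurable_ccvg hm hf.
have H (u : nat -> R -> R) (v : R -> R) : (forall n, measurable_fun D (u n)) ->
    (forall x, D x -> u^~ x @ \oo --> v x) -> (forall n x, D x -> `|u n x| <= k x) ->
    measurable_fun D v ->
    (fun n => \int[mu]_(x in D) u n x) @ \oo --> \int[mu]_(x in D) v x.
  move=> um uv uk vm.
  have [||||iv _ uvi] := @dominated_convergence _ _ _ mu D mD (fun n x => (u n x)%:E)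
    (EFin \o v) (EFin \o k) _ _ _ ik.
  - by move=> n; apply/measurable_EFinP; exact: um.
  - by apply/measurable_EFinP; exact: vm.
  - by apply: aeW => x Dx; apply: cvg_EFin (uv x Dx); exact: nearW.
  - by apply: aeW => x n Dx; rewrite lee_fin uk.
  apply: fine_cvg; rewrite /Rintegral fineK//.
  by apply: integrable_fin_num.
split; apply: H => //.
- by move=> n; have [] := hm n.
- by move=> x Dx; have [] := hf x Dx.
- by move=> n x Dx; apply: le_trans (Re_le_nc _) (hk n x Dx).
- by move=> n; have [] := hm n.
- by move=> x Dx; have [] := hf x Dx.
- by move=> n x Dx; apply: le_trans (Im_le_nc _) (hk n x Dx).
Qed.

End ComplexIntegral.

(** * From sequential continuity to measurability and integrability *)

Section SequentialContinuity.
Context {R : realType}.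
Implicit Types (f : R -> R) (q : R[i] -> R[i]).

(** Points at distance below 1/(n + 1) that violate continuity would form a sequence converging to
    [x]. This links convergence along sequences to the filter continuity that measurability and
    integrability rest on. *)
Lemma seq_continuous f x :
  (forall u : nat -> R, u @ \oo --> x -> (f \o u) @ \oo --> f x) ->
  f @ x --> f x.
Proof.
move=> fx; apply/cvgrPdist_lt => e e0; apply: contrapT => nf.
have H n : exists y, `|x - y| < n.+1%:R^-1 /\ ~ `|f x - f y| < e.
  apply: contrapT => ny; apply: nf.
  exists n.+1%:R^-1; first by rewrite /= invr_gt0 ltr0n.
  by move=> y xy; apply: contrapT => fy; apply: ny; exists y.
have [u uP] := choice H.
have ux : u @ \oo --> x.
  apply/cvgrPdist_lt => d d0.
  move/cvgrPdist_lt : (@cvg_harmonic R) => /(_ _ d0); apply: filterS => n.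
  by rewrite sub0r normrN ger0_norm ?harmonic_ge0// => nd; have [/lt_trans + _] := uP n; apply.
have /cvgrPdist_lt/(_ _ e0)[N _ /(_ _ (leqnn N))] := fx u ux.
by have [_] := uP N.
Qed.

Lemma ccvg_complex (u v : nat -> R) (x y : R) :
  u @ \oo --> x -> v @ \oo --> y -> ccvg (fun n => u n +i* v n) (x +i* y).
Proof. by []. Qed.

Lemma seq_cintegrable (phi : R -> R[i]) (a b : R) :
  (forall x, x \in `[a, b] -> forall u : nat -> R, u @ \oo --> x ->
    ccvg (phi \o u) (phi x)) ->
  cintegrable `[a, b] phi.
Proof.
move=> phic; split; apply: continuous_compact_integrable (@segment_compact _ a b) _;
  apply: continuous_in_subspaceT => x; rewrite inE/= => xab;
  by apply: seq_continuous => u /(phic x xab)[].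
Qed.

Lemma cderiv_horizontal q (y a b : R) : 0 < y ->
  (forall x, x \in `[a, b] -> exists d, cderiv q (x +i* y) d) ->
  cintegrable `[a, b] (fun x => q (x +i* y)).
Proof.
move=> y0 qd; apply: seq_cintegrable => x /qd[d dq] u ux.
by apply: (cderiv_ccvg _ dq) => //; apply: ccvg_complex => //; exact: cvg_cst.
Qed.

Lemma cderiv_vertical q (x a b : R) : 0 < a ->
  (forall y, y \in `[a, b] -> exists d, cderiv q (x +i* y) d) ->
  cintegrable `[a, b] (fun y => q (x +i* y)).
Proof.
move=> a0 qd; apply: seq_cintegrable => y yab u uy; have [d dq] := qd y yab.
apply: (cderiv_ccvg _ dq) => /=.
  by move: yab; rewrite in_itv/= => /andP[/(lt_le_trans a0)].
by apply: ccvg_complex => //; exact: cvg_cst.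
Qed.

End SequentialContinuity.

(** * Goursat's theorem for boxes *)

Section Goursat.
Context {R : realType}.
Variable q : R[i] -> R[i].
Implicit Types a b l m x y : R.
Local Notation ii := (0 +i* 1 : R[i]).

(** The counterclockwise boundary integral. Opposite sides are paired under one integral, so that an
    affine function contributes two constants that cancel. *)
Definition box_integral (a l b m : R) : R[i] :=
  cintegral `[a, a + l] (fun x => q (x +i* b) - q (x +i* (b + m))) +
  ii * cintegral `[b, b + m] (fun y => q ((a + l) +i* y) - q (a +i* y)).

Definition holo_box (a l b m : R) := forall x y,
  x \in `[a, a + l] -> y \in `[b, b + m] -> exists d, cderiv q (x +i* y) d.

Lemma holo_boxS a l b m a' l' b' m' :
  a <= a' -> a' + l' <= a + l -> b <= b' -> b' + m' <= b + m ->
  holo_box a l b m -> holo_box a' l' b' m'.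
Proof.
move=> aa ll bb mm H x y; rewrite !in_itv/= => /andP[? ?] /andP[? ?].
by apply: H; rewrite in_itv/=; apply/andP; split; lra.
Qed.

Lemma holo_box_h a l b m y : 0 <= m -> 0 < b -> holo_box a l b m ->
  y \in `[b, b + m] -> cintegrable `[a, a + l] (fun x => q (x +i* y)).
Proof.
move=> m0 b0 H yb; apply: cderiv_horizontal; last by move=> x /H; exact.
by move: yb; rewrite in_itv/= => /andP[/(lt_le_trans b0)].
Qed.

Lemma holo_box_v a l b m x : 0 <= l -> 0 < b -> holo_box a l b m ->
  x \in `[a, a + l] -> cintegrable `[b, b + m] (fun y => q (x +i* y)).
Proof. by move=> l0 b0 H xa; apply: cderiv_vertical => // y; exact: H. Qed.

Lemma box_split_h a l l' b m : 0 <= l -> 0 <= l' -> 0 <= m -> 0 < b ->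
  holo_box a (l + l') b m ->
  box_integral a (l + l') b m = box_integral a l b m + box_integral (a + l) l' b m.
Proof.
move=> l0 l'0 m0 b0 H; rewrite /box_integral !(addrA a l l').
have bm : b \in `[b, b + m] by rewrite in_itv/= lexx lerDl.
have bm' : b + m \in `[b, b + m] by rewrite in_itv/= lexx lerDl m0.
have ll' : 0 <= l + l' by rewrite addr_ge0.
have hb := holo_box_h m0 b0 H bm; have hb' := holo_box_h m0 b0 H bm'.
rewrite !(addrA a l l') in hb hb'.
rewrite (@cintegral_itv_split _ a (a + l)) ?lerDl//; last exact: cintegrableB.
have v0 := @holo_box_v _ _ _ _ a ll' b0 H; rewrite in_itv/= lexx lerDl ll' in v0.
have v1 := @holo_box_v _ _ _ _ (a + l) ll' b0 H.
rewrite in_itv/= lerDl l0 lerD2l lerDl l'0 in v1.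
have v2 := @holo_box_v _ _ _ _ (a + l + l') ll' b0 H.
rewrite in_itv/= -addrA lexx lerDl ll' in v2; rewrite addrA in v2.
rewrite !(@cintegralB _ `[b, b + m])//; try by [exact: v0|exact: v1|exact: v2].
ring.
Qed.

Lemma box_split_v a l b m m' : 0 <= l -> 0 <= m -> 0 <= m' -> 0 < b ->
  holo_box a l b (m + m') ->
  box_integral a l b (m + m') = box_integral a l b m + box_integral a l (b + m) m'.
Proof.
move=> l0 m0 m'0 b0 H; rewrite /box_integral !(addrA b m m').
have al : a \in `[a, a + l] by rewrite in_itv/= lexx lerDl.
have al' : a + l \in `[a, a + l] by rewrite in_itv/= lexx lerDl l0.
have mm' : 0 <= m + m' by rewrite addr_ge0.
have va := holo_box_v l0 b0 H al; have va' := holo_box_v l0 b0 H al'.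
rewrite !(addrA b m m') in va va'.
rewrite (@cintegral_itv_split _ b (b + m)) ?lerDl//; last exact: cintegrableB.
have h0 := @holo_box_h _ _ _ _ b mm' b0 H; rewrite in_itv/= lexx lerDl mm' in h0.
have h1 := @holo_box_h _ _ _ _ (b + m) mm' b0 H.
rewrite in_itv/= lerDl m0 lerD2l lerDl m'0 in h1.
have h2 := @holo_box_h _ _ _ _ (b + m + m') mm' b0 H.
rewrite in_itv/= -addrA lexx lerDl mm' in h2; rewrite addrA in h2.
rewrite mulrDr !(@cintegralB _ `[a, a + l])//; try by [exact: h0|exact: h1|exact: h2].
ring.
Qed.

(* the integral of the affine part [c + d (s - p)] around the box vanishes *)
Lemma box_integral_le a l b m (p c d : R[i]) (K : R) :
  0 <= l -> 0 <= m -> 0 < b -> holo_box a l b m ->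
  (forall x y, x \in `[a, a + l] -> y \in `[b, b + m] ->
    nc (q (x +i* y) - c - d * (x +i* y - p)) <= K) ->
  nc (box_integral a l b m) <= 4 * K * (l + m).
Proof.
move=> l0 m0 b0 H qK.
have al : a \in `[a, a + l] by rewrite in_itv/= lexx lerDl.
have al' : a + l \in `[a, a + l] by rewrite in_itv/= lexx lerDl l0.
have bm : b \in `[b, b + m] by rewrite in_itv/= lexx lerDl.
have bm' : b + m \in `[b, b + m] by rewrite in_itv/= lexx lerDl m0.
pose u x := q (x +i* b) - q (x +i* (b + m)).
pose v y := q ((a + l) +i* y) - q (a +i* y).
(* The affine part changes by [cu] from top to bottom and by [cv] from left to right. Since l cu + i
   m cv = 0, subtracting both leaves the boundary integral unchanged. *)
pose cu := - (ii * m%:C * d); pose cv := l%:C * d.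
have iu : cintegrable `[a, a + l] u.
  by apply: cintegrableB => //; exact: holo_box_h H _.
have iv : cintegrable `[b, b + m] v.
  by apply: cintegrableB => //; exact: holo_box_v H _.
have icst x y z : cintegrable `[x, y] (fun=> z : R[i]).
  by apply: (@bounded_cintegrable _ _ _ _ (nc z)) => //; exact: cmeasurable_cst.
have -> : box_integral a l b m = cintegral `[a, a + l] (fun x => u x - cu) +
    ii * cintegral `[b, b + m] (fun y => v y - cv).
  rewrite (@cintegralB _ _ u)// (@cintegralB _ _ v)// !cintegral_cst ?lerDl//.
  rewrite /box_integral -/u -/v.
  rewrite /cu /cv (addrC a) (addrC b) !addrK; ring.
apply: le_trans (le_normcD _ _) _; rewrite Normc.normcM nc_i mul1r.
(* Each pair of sides contributes [K + K], and [nc_cintegral_itv] a further factor 2. *)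
rewrite (_ : 4 * K * (l + m) = 2 * (K + K) * l + 2 * (K + K) * m); last by ring.
apply: lerD.
  rewrite -[X in _ <= _ * X](addrK a) (addrC l); apply: nc_cintegral_itv.
  - by rewrite lerDl.
  - by apply: cmeasurableB (cmeasurable_cst _ _); exact: cintegrable_measurable.
  move=> x xa; rewrite (_ : u x - cu = (q (x +i* b) - c - d * (x +i* b - p)) -
      (q (x +i* (b + m)) - c - d * (x +i* (b + m) - p))).
    by apply: le_trans (ncB _ _) _; apply: lerD; exact: qK.
  rewrite /u /cu (_ : x +i* (b + m) = x +i* b + ii * m%:C); first by ring.
  by apply: complex_ext => /=; ring.
rewrite -[X in _ <= _ * X](addrK b) (addrC m); apply: nc_cintegral_itv.
- by rewrite lerDl.
- by apply: cmeasurableB (cmeasurable_cst _ _); exact: cintegrable_measurable.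
move=> y yb; rewrite (_ : v y - cv = (q ((a + l) +i* y) - c - d * ((a + l) +i* y - p)) -
    (q (a +i* y) - c - d * (a +i* y - p))).
  by apply: le_trans (ncB _ _) _; apply: lerD; exact: qK.
rewrite /v /cv (_ : (a + l) +i* y = a +i* y + l%:C); first by ring.
by apply: complex_ext => /=; ring.
Qed.

Lemma le_sum4_or (x x1 x2 x3 x4 : R) : x <= (x1 + x2) + (x3 + x4) ->
  [\/ x <= 4 * x1, x <= 4 * x2, x <= 4 * x3 | x <= 4 * x4].
Proof.
move=> xs; have [h1|h1] := leP x (4 * x1); first by constructor 1.
have [h2|h2] := leP x (4 * x2); first by constructor 2.
have [h3|h3] := leP x (4 * x3); first by constructor 3.
by constructor 4; lra.
Qed.

(** Pigeonhole: the integrals over the four quarters add up to that over the whole box. *)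
Lemma box_quarter a l b m : 0 <= l -> 0 <= m -> 0 < b -> holo_box a l b m ->
  exists a' b', [/\ a <= a', a' + l / 2 <= a + l, b <= b', b' + m / 2 <= b + m &
    nc (box_integral a l b m) <= 4 * nc (box_integral a' (l / 2) b' (m / 2))].
Proof.
move=> l0 m0 b0 H.
have l20 : 0 <= l / 2 by rewrite divr_ge0.
have m20 : 0 <= m / 2 by rewrite divr_ge0.
have H1 := H; rewrite (splitr l) in H1.
have E := box_split_h l20 l20 m0 b0 H1; rewrite -splitr in E.
have Ha : holo_box a (l / 2) b (m / 2 + m / 2).
  by apply: holo_boxS H => //; lra.
have Hb : holo_box (a + l / 2) (l / 2) b (m / 2 + m / 2).
  by apply: holo_boxS H => //; lra.
have Ea := box_split_v l20 m20 m20 b0 Ha; rewrite -splitr in Ea.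
have Eb := box_split_v l20 m20 m20 b0 Hb; rewrite -splitr in Eb.
rewrite {}Ea {}Eb in E.
have half_le (c u : R) : 0 <= u -> c + u / 2 <= c + u.
  by move=> u0; rewrite lerD2l ler_pdivrMr// ler_peMr// ler1n.
have half_eq (c u : R) : c + u / 2 + u / 2 <= c + u by rewrite -addrA -splitr.
have : nc (box_integral a l b m) <=
    (nc (box_integral a (l / 2) b (m / 2)) + nc (box_integral a (l / 2) (b + m / 2) (m / 2))) +
    (nc (box_integral (a + l / 2) (l / 2) b (m / 2)) +
     nc (box_integral (a + l / 2) (l / 2) (b + m / 2) (m / 2))).
  rewrite E; apply: le_trans (le_normcD _ _) _.
  by apply: lerD; exact: le_normcD.
case/le_sum4_or => h4; [exists a, b|exists a, (b + m / 2)|exists (a + l / 2), b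
  |exists (a + l / 2), (b + m / 2)]; split => //; by rewrite ?lerDl ?half_le ?half_eq.
Qed.

(** The supremum of the left endpoints works, because every right endpoint bounds all of them. *)
Lemma nested_halving (s : nat -> R) (c : R) : 0 <= c ->
  (forall n, s n <= s n.+1) ->
  (forall n, s n.+1 + c / 2 ^+ n.+1 <= s n + c / 2 ^+ n) ->
  exists p, forall n, s n <= p /\ p <= s n + c / 2 ^+ n.
Proof.
move=> c0 s_nd s_ni.
have cge0 n : 0 <= c / 2 ^+ n by rewrite divr_ge0// exprn_ge0.
have nd : {homo s : i j / (i <= j)%N >-> i <= j}.
  by apply: homo_leq => //; exact: le_trans.
have ni i j : (i <= j)%N -> s j + c / 2 ^+ j <= s i + c / 2 ^+ i.
  move=> ij; rewrite -(subnKC ij); elim: (j - i)%N => [|k IH]; first by rewrite addn0.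
  by rewrite addnS; apply: le_trans IH.
have ub n : ubound (range s) (s n + c / 2 ^+ n).
  move=> _ [k _ <-]; have [kn|nk] := leqP k n.
    by apply: le_trans (nd _ _ kn) _; rewrite lerDl.
  by apply: le_trans _ (ni _ _ (ltnW nk)); rewrite lerDl.
exists (sup (range s)) => n; split.
  by apply: ub_le_sup; [exists (s 0%N + c / 2 ^+ 0)|exists n].
by apply: ge_sup; [exists (s 0%N); exists 0%N|exact: ub].
Qed.

Theorem goursat_box a l b m : 0 < l -> 0 < m -> 0 < b -> holo_box a l b m ->
  box_integral a l b m = 0.
Proof.
move=> l0 m0 b0 H; apply/eqP; rewrite -nc_eq0; apply: contraT => E0.
pose E := nc (box_integral a l b m).
have {}E0 : 0 < E by rewrite lt_neqAle eq_sym E0 nc_ge0.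
pose L n := l / 2 ^+ n; pose M n := m / 2 ^+ n.
have L0 n : 0 <= L n by rewrite divr_ge0 ?exprn_ge0// ltW.
have M0 n : 0 <= M n by rewrite divr_ge0 ?exprn_ge0// ltW.
have LS n : L n.+1 = L n / 2 by rewrite /L exprSr invfM mulrA.
have MS n : M n.+1 = M n / 2 by rewrite /M exprSr invfM mulrA.
pose P n (s s' : R * R) := [/\ s.1 <= s'.1, s'.1 + L n.+1 <= s.1 + L n,
  s.2 <= s'.2, s'.2 + M n.+1 <= s.2 + M n &
  nc (box_integral s.1 (L n) s.2 (M n)) <=
    4 * nc (box_integral s'.1 (L n.+1) s'.2 (M n.+1))].
(* The default of [xget] is never reached: under the invariant [Q], [box_quarter] supplies a
   successor satisfying [P]. *)
pose s := fix s n := if n is k.+1 then xget (a, b) (P k (s k)) else (a, b).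
pose Q n (s : R * R) := [/\ a <= s.1, s.1 + L n <= a + l, b <= s.2,
  s.2 + M n <= b + m & E <= 4 ^+ n * nc (box_integral s.1 (L n) s.2 (M n))].
have holoQ n s0 : Q n s0 -> holo_box s0.1 (L n) s0.2 (M n).
  by case=> ? ? ? ? _; apply: holo_boxS H.
have QP n : Q n (s n) -> P n (s n) (s n.+1).
  move=> Qn; have hQ := holoQ _ _ Qn; case: Qn => [_ _ bs _ _].
  have [a' [b' s'P]] := box_quarter (L0 n) (M0 n) (lt_le_trans b0 bs) hQ.
  rewrite -LS -MS in s'P; have {}s'P : P n (s n) (a', b') by [].
  change (s n.+1) with (xget (a, b) (P n (s n))); exact: xgetI s'P.
have Qs n : Q n (s n).
  elim: n => [|n Qn]; first by rewrite /Q /= /L /M expr0 !divr1 mul1r.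
  have [? ? ? ? ?] := QP _ Qn; case: Qn => [? ? ? ? ?].
  split; try lra.
  by rewrite exprSr -mulrA; apply: le_trans (ler_wpM2l _ _); eauto; rewrite exprn_ge0.
have Ps n : P n (s n) (s n.+1) by exact: QP.
have [p1 p1P] : exists p, forall n, (s n).1 <= p /\ p <= (s n).1 + L n.
  by apply: (@nested_halving (fun n => (s n).1)) => [|n|n]; [exact: ltW|case: (Ps n)..].
have [p2 p2P] : exists p, forall n, (s n).2 <= p /\ p <= (s n).2 + M n.
  by apply: (@nested_halving (fun n => (s n).2)) => [|n|n]; [exact: ltW|case: (Ps n)..].
have lm0 : 0 < l + m by rewrite addr_gt0.
have p2b : b <= p2 by have [+ _] := p2P 0%N; rewrite /=.
have [d qd] : exists d, cderiv q (p1 +i* p2) d.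
  have := p1P 0%N; have := p2P 0%N; rewrite /L /M /= !expr0 !divr1 => -[? ?] [? ?].
  by apply: H; rewrite in_itv/=; apply/andP.
(* The n-th box integral will be at most 4 e ((l + m) / 2^n)^2, while it is at least E / 4^n; with
   this [e], 4^n times the upper bound is [E / 2]. *)
pose e := E / (8 * (l + m) ^+ 2).
have e0 : 0 < e by rewrite divr_gt0// mulr_gt0// exprn_gt0.
have Imp : 0 < Im (p1 +i* p2) by exact: lt_le_trans p2b.
have [r r0 rP] := cderiv_eps Imp qd e0.
have [n nr] : exists n, (l + m) / 2 ^+ n < r.
  have := @cvg_geometric R (l + m) 2^-1; rewrite ger0_norm ?invf_lt1 ?ltr1n// => /(_ isT).
  move=> /cvgrPdist_lt/(_ _ r0)[n _ /(_ n (leqnn n))] /=.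
  rewrite sub0r normrN exprVn ger0_norm; first by exists n.
  by rewrite divr_ge0 ?exprn_ge0// ltW.
have [as_ sa bs sb En] := Qs n.
have LMn : L n + M n = (l + m) / 2 ^+ n by rewrite -mulrDl.
have Bn := box_integral_le (p := p1 +i* p2) (c := q (p1 +i* p2)) (d := d)
  (K := e * (L n + M n)) (L0 n) (M0 n) (lt_le_trans b0 bs) (holoQ _ _ (Qs n)).
rewrite {}LMn in Bn; have {}Bn := Bn _.
have {}Bn : nc (box_integral (s n).1 (L n) (s n).2 (M n)) <=
    4 * (e * ((l + m) / 2 ^+ n)) * ((l + m) / 2 ^+ n).
  apply: Bn => x y.
  rewrite !in_itv/= => /andP[x1 x2] /andP[y1 y2].
  have [? ?] := p1P n; have [? ?] := p2P n.
  pose h := (x +i* y) - (p1 +i* p2).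
  have hn : nc h <= (l + m) / 2 ^+ n.
    rewrite mulrDl -/(L n) -/(M n); apply: le_trans (nc_le_ReIm _) _.
    by rewrite /h /=; apply: lerD; rewrite ler_norml; apply/andP; split; lra.
  have := rP h (le_lt_trans hn nr); rewrite /h subrKC => /le_trans; apply.
  by rewrite ler_pM2l.
have : 4 ^+ n * (4 * (e * ((l + m) / 2 ^+ n)) * ((l + m) / 2 ^+ n)) = E / 2.
  rewrite (_ : 4 = 2 ^+ 2 :> R) -?exprM; last by rewrite -natrX.
  rewrite mulnC exprM /e; field.
  by rewrite expf_neq0//= gt_eqF.
move=> En2; have : E <= E / 2.
  by rewrite -En2; apply: le_trans En _; rewrite ler_pM2l// exprn_gt0.
by move=> ?; exfalso; lra.
Qed.

End Goursat.

(** * The Poisson kernel of the upper half plane *)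

Section PoissonKernel.
Context {R : realType}.
Local Notation mu := (@lebesgue_measure R).
Implicit Types x y t : R.

(** A constant multiple of this kernel also dominates the integrands of the contour argument,
    uniformly over the lines. *)
Definition poisson_kernel x y t : R := y / ((t - x) ^+ 2 + y ^+ 2).

Lemma poisson_den_gt0 x y t : 0 < y -> 0 < (t - x) ^+ 2 + y ^+ 2.
Proof. by move=> y0; rewrite ltr_wpDl ?sqr_ge0// exprn_gt0. Qed.

Lemma poisson_kernel_ge0 x y t : 0 < y -> 0 <= poisson_kernel x y t.
Proof. by move=> y0; rewrite divr_ge0 ?ltW// poisson_den_gt0. Qed.

Lemma continuous_poisson_kernel x y : 0 < y -> continuous (poisson_kernel x y).
Proof.
move=> y0 t; apply: cvgM; first exact: cvg_cst.
apply: cvgV; first by rewrite gt_eqF// poisson_den_gt0.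
apply: cvgD; last exact: cvg_cst.
rewrite expr2; under eq_fun do rewrite expr2.
by apply: cvgM; apply: cvgB; [exact: cvg_id|exact: cvg_cst|exact: cvg_id|exact: cvg_cst].
Qed.

Lemma poisson_kernel_half x y : 0 < y ->
  (\int[mu]_(t in `[x, +oo[) (poisson_kernel x y t)%:E = (pi / 2)%:E)%E.
Proof.
move=> y0; pose F t := atan ((t - x) / y).
have dF t : is_derive t 1 F (poisson_kernel x y t).
  have H : is_derive t 1 (fun t : R => (t - x) / y) y^-1.
    have -> : (fun t : R => (t - x) / y) = (fun t => y^-1 *: (t - x)).
      by apply/funext => s; rewrite /GRing.scale/= mulrC.
    by apply: is_derive_eq; rewrite subr0; exact: mulr1.
  apply: is_derive_eq (is_derive1_comp (is_derive1_atan _) H) _.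
  rewrite /poisson_kernel; field.
  by rewrite !gt_eqF ?poisson_den_gt0// addrC poisson_den_gt0.
have F0 : F x = 0 by rewrite /F subrr mul0r atan0.
rewrite (@ge0_continuous_FTC2y _ _ F _ (pi / 2)) ?F0 ?sube0//.
- by move=> t _; exact: poisson_kernel_ge0.
- by apply: continuous_subspaceT => t; exact: continuous_poisson_kernel.
- apply: (cvg_comp (fun t => (t - x) / y) atan _ (@cvgy_atan R)).
  apply/cvgryPge => A; near=> t.
  rewrite ler_pdivlMr// lerBrDr; near: t; apply: nbhs_pinfty_ge; exact: num_real.
- by apply: cvg_at_right_filter; rewrite -F0; apply: differentiable_continuous; apply/derivable1_diffP.
- by move=> t _; rewrite derive1E derive_val.
Unshelve. all: by end_near. Qed.

Lemma poisson_kernel_integral x y : 0 < y ->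
  (\int[mu]_t (poisson_kernel x y t)%:E = pi%:E)%E.
Proof.
move=> y0; have mk : measurable_fun setT (poisson_kernel x y).
  by apply: continuous_measurable_fun; exact: continuous_poisson_kernel.
rewrite -(itv_setU_setT true x) ge0_integral_setU//=; first last.
- apply/disj_setPS => t [/=]; rewrite !in_itv/= andbT => tx xt.
  by have := lt_le_trans tx xt; rewrite ltxx.
- by move=> t _; rewrite lee_fin; exact: poisson_kernel_ge0.
- by apply/measurable_EFinP; exact: measurable_funTS.
rewrite poisson_kernel_half// integral_itv_bndo_bndc; last first.
  by apply/measurable_EFinP; exact: measurable_funTS.
(* The reflection [t -> - t] carries the left half-line to a right one and the centre to [- x]. *)
rewrite -(opprK x) ge0_integration_by_substitutionNy.
- rewrite (_ : (fun t => _) = (fun t => (poisson_kernel (- x) y t)%:E)).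
    by rewrite poisson_kernel_half// -EFinD -splitr.
  by apply/funext => t; congr EFin; rewrite /= /poisson_kernel; congr (_ / (_ + _)); ring.
- by apply: continuous_subspaceT => t; exact: continuous_poisson_kernel.
- by move=> t _; exact: poisson_kernel_ge0.
Qed.

Lemma integrable_poisson_kernel x y : 0 < y ->
  mu.-integrable setT (EFin \o poisson_kernel x y).
Proof.
move=> y0; apply/integrableP; split.
  apply/measurable_EFinP; apply: continuous_measurable_fun.
  exact: continuous_poisson_kernel.
under eq_integral do rewrite /= ger0_norm ?poisson_kernel_ge0//.
by rewrite poisson_kernel_integral// ltry.
Qed.

Lemma Rintegral_poisson_kernel x y : 0 < y -> \int[mu]_t poisson_kernel x y t = pi.
Proof. by move=> y0; rewrite /Rintegral poisson_kernel_integral. Qed.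

End PoissonKernel.

(** * Poisson's formula in the upper half plane *)

Section LineIntegral.
Context {R : realType}.
Local Notation mu := (@lebesgue_measure R).
Local Notation ii := (0 +i* 1 : R[i]).
Implicit Types (q : R[i] -> R[i]) (x y t s b c K : R).

Lemma cderiv_line_measurable q y : 0 < y ->
  (forall t, exists d, cderiv q (t +i* y) d) -> cmeasurable setT (fun t => q (t +i* y)).
Proof.
move=> y0 qd.
have H t u : u @ \oo --> t -> ccvg (fun n => q (u n +i* y)) (q (t +i* y)).
  move=> ut; have [d dq] := qd t; apply: (cderiv_ccvg _ dq) => //.
  by apply: ccvg_complex => //; exact: cvg_cst.
by split; apply: continuous_measurable_fun => t; apply: seq_continuous => u /H[].
Qed.

Lemma cintegral_indic (D : set R) (f : R -> R[i]) :
  cintegral D f = cintegral setT (fun t => (\1_D t)%:C * f t).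
Proof.
apply: complex_ext; rewrite /= Rintegral_mkcond; apply: eq_Rintegral => t _;
  rewrite patchE ?ReM ?ImM /= indicE; case: (t \in D);
  by rewrite /= ?mul1r ?mul0r ?subr0 ?addr0.
Qed.

(* [y^2 t^2 <= (x^2 + y^2) ((t - x)^2 + y^2)] by Cauchy-Schwarz *)
Lemma poisson_kernel_le x y t : 0 < y -> 1 <= `|t| ->
  poisson_kernel x y t <= (x ^+ 2 + y ^+ 2) / y / `|t|.
Proof.
move=> y0 t1; have t0 : 0 < `|t| by exact: lt_le_trans t1.
rewrite /poisson_kernel ler_pdivrMr ?poisson_den_gt0//.
rewrite (_ : _ / y / `|t| * _ =
    (x ^+ 2 + y ^+ 2) * ((t - x) ^+ 2 + y ^+ 2) / (y * `|t|)); last first.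
  by field; rewrite !gt_eqF.
rewrite ler_pdivlMr ?mulr_gt0// mulrA -expr2.
apply: (@le_trans _ _ (y ^+ 2 * `|t| ^+ 2)).
  by rewrite ler_pM2l ?exprn_gt0// expr2 ler_peMr// ltW.
rewrite real_normK ?num_real//.
have : 0 <= (x * t - (x ^+ 2 + y ^+ 2)) ^+ 2 by exact: sqr_ge0.
by rewrite !expr2; nra.
Qed.

(** Goursat's theorem on [-N, N] x [b, c], with N tending to infinity. The horizontal sides converge
    because the kernel is integrable, and the vertical ones are O(1/N) by [poisson_kernel_le]. *)
Lemma line_integral_cst q x y K b c : 0 < y -> 0 < b -> b < c ->
  (forall t s, b <= s -> s <= c -> exists d, cderiv q (t +i* s) d) ->
  (forall t s, b <= s -> s <= c -> nc (q (t +i* s)) <= K * poisson_kernel x y t) ->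
  cintegral setT (fun t => q (t +i* b)) = cintegral setT (fun t => q (t +i* c)).
Proof.
move=> y0 b0 bc qd qK; have c0 := lt_trans b0 bc.
have ik : mu.-integrable setT (EFin \o (fun t => K * poisson_kernel x y t)).
  exact: (integrableZl _ K (integrable_poisson_kernel x y0)).
have mb : cmeasurable setT (fun t => q (t +i* b)).
  by apply: cderiv_line_measurable => // t; apply: qd => //; exact: ltW.
have mc : cmeasurable setT (fun t => q (t +i* c)).
  by apply: cderiv_line_measurable => // t; apply: qd => //; exact: ltW.
have kb t : nc (q (t +i* b)) <= K * poisson_kernel x y t by apply: qK => //; exact: ltW.
have kc t : nc (q (t +i* c)) <= K * poisson_kernel x y t by apply: qK => //; exact: ltW.
pose phi t := q (t +i* b) - q (t +i* c).
apply/eqP; rewrite -subr_eq0 -cintegralB//; last 2 first.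
- exact: (dominated_cintegrable measurableT mb ik (fun t _ => kb t)).
- exact: (dominated_cintegrable measurableT mc ik (fun t _ => kc t)).
have mphi : cmeasurable setT phi by exact: cmeasurableB.
pose D n : set R := `[- n.+1%:R, n.+1%:R]%classic.
have lim1 : ccvg (fun n => cintegral (D n) phi) (cintegral setT phi).
  under eq_fun do rewrite cintegral_indic.
  apply: (@cintegral_ccvg _ _ _ _ (fun t => 2 * (K * poisson_kernel x y t))) => //.
  - move=> n; apply: cmeasurableM => //; apply: cmeasurable_real.
    have /= := @measurable_indic _ _ R setT (D n) (measurable_itv _); exact.
  - move=> t _; apply: ccvg_near (ccvg_cst (phi t)).
    have := nbhs_infty_gtr `|t|; apply: filterS => n /ltW tn.
    have tD : D n t by rewrite /D /= in_itv/= -ler_norml (le_trans tn)// ler_nat.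
    by rewrite indicE mem_set// mul1r.
  - exact: (integrableZl _ 2 ik).
  - move=> n t _; rewrite Normc.normcM nc_real.
    apply: (@le_trans _ _ (nc (phi t))).
      rewrite ler_piMl ?nc_ge0// indicE; case: (_ \in _) => /=;
      by rewrite ?normr1 ?normr0.
    by apply: le_trans (ncB _ _) _; have := kb t; have := kc t; lra.
(* One factor 2 comes from [nc_cintegral_itv], the other from the two vertical sides, whose length
   is [c - b]. *)
pose e n : R := 2 * (2 * (`|K| * ((x ^+ 2 + y ^+ 2) / y * n.+1%:R^-1))) * (c - b).
have lim2 : ccvg (fun n => cintegral (D n) phi) 0.
  apply: (@squeeze_ccvg _ _ _ e); last first.
    rewrite (_ : e = fun n => 4 * (`|K| * ((x ^+ 2 + y ^+ 2) / y)) * (c - b) * n.+1%:R^-1).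
      rewrite -(mulr0 (4 * (`|K| * ((x ^+ 2 + y ^+ 2) / y)) * (c - b))).
      by apply: cvgM; [exact: cvg_cst|exact: cvg_harmonic].
    by apply/funext => n; rewrite /e; ring.
  move=> n; rewrite subr0.
  have n0 : 0 < (n.+1%:R : R) by rewrite ltr0n.
  have qn s t : `|t| = n.+1%:R -> b <= s -> s <= c ->
      nc (q (t +i* s)) <= `|K| * ((x ^+ 2 + y ^+ 2) / y * n.+1%:R^-1).
    move=> tn bs sc; apply: le_trans (qK t s bs sc) _.
    apply: (@le_trans _ _ (`|K| * poisson_kernel x y t)).
      by rewrite ler_wpM2r ?ler_norm// poisson_kernel_ge0.
    by rewrite ler_wpM2l// -tn poisson_kernel_le// tn ler1n.
  have := @goursat_box _ q (- n.+1%:R) (n.+1%:R + n.+1%:R) b (c - b).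
  rewrite /box_integral !subrKC addrA addNr add0r => /(_ _ _ b0 _)/eqP.
  rewrite addr_eq0 => G.
  rewrite (eqP (G _ _ _)) ?subr_gt0 ?addr_gt0//; last first.
    move=> t s _; rewrite in_itv/= subrKC => /andP[bs sc]; exact: qd.
  have Nn : `|- n.+1%:R| = n.+1%:R :> R by rewrite normrN ger0_norm// ltW.
  have Pn : `|n.+1%:R| = n.+1%:R :> R by rewrite ger0_norm// ltW.
  rewrite normcN Normc.normcM nc_i mul1r; apply: nc_cintegral_itv; first exact: ltW.
    apply: cintegrable_measurable; apply: cintegrableB => //;
    by apply: cderiv_vertical => // s; rewrite in_itv/= => /andP[? ?]; exact: qd.
  move=> s /=; rewrite in_itv/= => /andP[bs sc]; apply: le_trans (ncB _ _) _.
  by rewrite mulr_natl mulr2n; apply: lerD; exact: qn.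
by rewrite (ccvg_uniq lim1 lim2).
Qed.

End LineIntegral.

(** Continuity is asked at real points only, along sequences in the closed half plane; in the
    interior it follows from differentiability. *)
Record bounded_holomorphic {R : realType} (h : R[i] -> R[i]) (B : R) : Prop :=
  BoundedHolomorphic {
  bounded_holo_le : forall w, 0 <= Im w -> nc (h w) <= B ;
  bounded_holo_boundary : forall (t : R) (u : nat -> R[i]),
    (forall n, 0 <= Im (u n)) -> ccvg u t%:C -> ccvg (h \o u) (h t%:C) ;
  bounded_holo_cderiv : forall w, 0 < Im w -> exists d, cderiv h w d }.

Section PoissonFormula.
Context {R : realType}.
Local Notation mu := (@lebesgue_measure R).
Variables (h : R[i] -> R[i]) (B : R).
Hypothesis hB : bounded_holomorphic h B.

Lemma cderiv_near (f g : R[i] -> R[i]) s d r : 0 < r ->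
  (forall s', nc (s' - s) < r -> f s' = g s') -> cderiv f s d -> cderiv g s d.
Proof.
move=> r0 fg fd u u0 us uc; apply: ccvg_near (fd u u0 us uc).
apply: filterS (ccvg_eps uc r0) => n; rewrite subr0 => un.
by rewrite !fg ?subrr ?nc0// addrC addKr.
Qed.

Lemma bounded_holo_ge0 : 0 <= B.
Proof. by apply: le_trans (nc_ge0 (h 0)) _; apply: (bounded_holo_le hB). Qed.

(** Within the radius [r] the derivative controls the quotient; beyond it
    [2 * B <= 2 * B / r * nc (s - w)]. With [nc d <= L], the same [L] bounds the value assigned to
    the quotient at [w]. *)
Lemma bounded_holo_quotient_le w d : 0 < Im w -> cderiv h w d ->
  exists2 L, nc d <= L & forall s, 0 <= Im s -> nc (h s - h w) <= L * nc (s - w).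
Proof.
move=> w0 hd; have [r r0 rP] := cderiv_lip w0 hd.
exists (nc d + 1 + 2 * B / r); first by rewrite -addrA lerDl addr_ge0// divr_ge0 ?mulr_ge0 ?bounded_holo_ge0// ltW.
move=> s s0; rewrite mulrDl; have [sr|sr] := ltP (nc (s - w)) r.
  have := rP _ sr; rewrite subrKC => /le_trans; apply; rewrite lerDl.
  by rewrite mulr_ge0 ?nc_ge0// divr_ge0 ?mulr_ge0 ?bounded_holo_ge0// ltW.
apply: (@le_trans _ _ (2 * B)).
  have := ncB (h s) (h w); have := bounded_holo_le hB s0.
  by have := bounded_holo_le hB (ltW w0); lra.
apply: (@le_trans _ _ (2 * B / r * nc (s - w))).
  rewrite -mulrA ler_peMr ?mulr_ge0 ?bounded_holo_ge0// mulrC.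
  by rewrite ler_pdivlMr// mul1r.
by rewrite lerDr mulr_ge0 ?nc_ge0// addr_ge0 ?nc_ge0.
Qed.

Section Pole.
Variables (x y : R) (y0 : 0 < y) (d : R[i]).
Let w := x +i* y.
Hypothesis hd : cderiv h w d.

(* extended by continuity at its removable singularity [w] *)
Let q (s : R[i]) := if s == w then d / (w - conjc w)
  else (h s - h w) / ((s - w) * (s - conjc w)).

Let nc_w t s : nc (t +i* s - w) ^+ 2 = (t - x) ^+ 2 + (s - y) ^+ 2.
Proof. by rewrite nc_sqr. Qed.

Let nc_wJ t s : nc (t +i* s - conjc w) ^+ 2 = (t - x) ^+ 2 + (s + y) ^+ 2.
Proof. by rewrite nc_sqr /= opprK. Qed.

Let wwJ : nc (w - conjc w) = 2 * y.
Proof.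
rewrite (_ : w - conjc w = (0 +i* 1) * (2 * y)%:C).
  by rewrite Normc.normcM nc_i mul1r nc_real ger0_norm// mulr_ge0// ltW.
by apply: complex_ext => /=; ring.
Qed.

(** Put p = t + i s and rho = |t - w|; the claim reduces to |q p| rho^2 <= 4 B + 2 y L, and |p -
    conj w| >= rho always. If |p - w| >= rho / 2, the bound 2 B on the numerator suffices; otherwise
    rho <= 2 y, and the quotient bound [L] does. *)
Let q_le : exists2 K : R, 0 <= K & forall t s : R, 0 <= s ->
  nc (q (t +i* s)) <= K * poisson_kernel x y t.
Proof.
have [L Ld LP] := bounded_holo_quotient_le (w := w) y0 hd.
have L0 : 0 <= L by exact: le_trans (nc_ge0 d) Ld.
have B0 := bounded_holo_ge0.
pose K := 4 * B + 2 * y * L.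
have K0 : 0 <= K by rewrite addr_ge0 ?mulr_ge0// ltW.
exists (K / y); first by rewrite divr_ge0// ltW.
move=> t s s0; pose rho := nc ((t - x) +i* y).
have rho2 : rho ^+ 2 = (t - x) ^+ 2 + y ^+ 2 by rewrite nc_sqr.
have rho_ge0 : 0 <= rho by exact: nc_ge0.
have rho0 : 0 < rho.
  by rewrite lt_neqAle rho_ge0 andbT eq_sym -sqrf_eq0 rho2 gt_eqF// poisson_den_gt0.
rewrite /poisson_kernel -rho2 mulrA divfK ?gt_eqF// ler_pdivlMr ?exprn_gt0//.
rewrite /q; case: eqP => [[tx sy]|sw].
  have -> : rho = y.
    by apply/eqP; rewrite -(@eqrXn2 _ 2)// ?ltW// rho2 tx subrr expr0n add0r.
  rewrite nc_div wwJ (_ : nc d / (2 * y) * y ^+ 2 = nc d * y / 2); last by field; rewrite gt_eqF.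
  have : nc d * y <= L * y by rewrite ler_pM2r.
  have : 0 <= nc d * y by rewrite mulr_ge0 ?nc_ge0// ltW.
  by rewrite /K; lra.
set a := nc (t +i* s - w); set c := nc (t +i* s - conjc w).
have a_ge0 : 0 <= a by exact: nc_ge0.
have a0 : 0 < a by rewrite /a nc_gt0 subr_eq0; apply/eqP.
have rc : rho <= c.
  rewrite -(@ler_pXn2r _ 2)// ?nnegrE ?nc_ge0// rho2 nc_wJ.
  by rewrite lerD2l ler_pXn2r ?nnegrE ?addr_ge0 ?(ltW y0)// lerDr.
have c0 : 0 < c by exact: lt_le_trans rc.
rewrite nc_div Normc.normcM -/a -/c mulrAC ler_pdivrMr ?mulr_gt0// expr2 !mulrA.
apply: ler_pM => //; first by rewrite mulr_ge0 ?nc_ge0.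
set H := nc _.
have [ar|ar] := leP rho (2 * a).
  apply: (@le_trans _ _ (2 * B * rho)).
    rewrite ler_pM2r//.
    have := ncB (h (t +i* s)) (h w); have := bounded_holo_le hB (ltW y0 : 0 <= Im w).
    by have := bounded_holo_le hB (s0 : 0 <= Im (t +i* s)); rewrite /H; lra.
  apply: (@le_trans _ _ (2 * B * (2 * a))); first by rewrite ler_wpM2l// mulr_ge0.
  have : 0 <= y * L * a by rewrite !mulr_ge0// ltW.
  by rewrite /K; nra.
have ry : rho <= 2 * y.
  rewrite -(@ler_pXn2r _ 2)// ?nnegrE ?mulr_ge0 ?(ltW y0)//.
  have : (t - x) ^+ 2 <= a ^+ 2 by rewrite nc_w lerDl sqr_ge0.
  have : (2 * a) ^+ 2 <= rho ^+ 2 by rewrite ler_pXn2r ?nnegrE ?mulr_ge0// ltW.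
  by have := sqr_ge0 y; rewrite !exprMn rho2; lra.
apply: (@le_trans _ _ (L * a * (2 * y))).
  by apply: ler_pM => //; [exact: nc_ge0|exact: LP].
have : 0 <= B * a by rewrite mulr_ge0.
by rewrite /K; nra.
Qed.

Let q_cderiv (s : R[i]) : 0 < Im s -> s != w -> exists e, cderiv q s e.
Proof.
move=> s0 sw; have [e he] := bounded_holo_cderiv hB s0.
have sJ : s - conjc w != 0.
  apply/eqP => /(congr1 (@complex.Im R)); rewrite ImD ImN ImJ opprK /= => E.
  by have := addr_gt0 s0 y0; rewrite E ltxx.
have dd : (s - w) * (s - conjc w) != 0 by rewrite mulf_neq0// subr_eq0.
have sub_d c : cderiv (fun s => s - c) s (1 - 0).
  by apply: cderivB; [exact: cderiv_id|exact: cderiv_cst].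
have H := cderivM s0 (cderivB he (@cderiv_cst _ (h w) s))
  (cderivV (f := fun s => (s - w) * (s - conjc w)) s0 dd (cderivM s0 (sub_d w) (sub_d (conjc w)))).
eexists; apply: (@cderiv_near _ _ _ _ (nc (s - w))) H.
  by rewrite nc_gt0 subr_eq0.
move=> s' s's; rewrite /q; case: eqP => // E.
by move: s's; rewrite E ncBC ltxx.
Qed.

(** At [w] this is the convergence of difference quotients, whence [u n != y] and, when [s = y],
    increments small enough for [cderiv]. Elsewhere above the real axis it follows from
    differentiability, and on the axis from continuity at the boundary. *)
Let q_ccvg (t s : R) (u : nat -> R) : 0 <= s -> u @ \oo --> s -> (forall n, 0 <= u n) ->
  (forall n, u n != y) -> (forall n, 2 * `|u n - y| <= y) \/ s != y ->
  ccvg (fun n => q (t +i* u n)) (q (t +i* s)).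
Proof.
move=> s0 us u0 uy uc.
have tus : ccvg (fun n => t +i* u n) (t +i* s).
  by apply: ccvg_complex => //; exact: cvg_cst.
have [E|sw] := eqVneq (t +i* s) w.
  case: E => tx sy; case: uc => [uc|]; last by rewrite sy eqxx.
  have tw : ccvg (fun n => t +i* u n) w by rewrite /w -tx -sy.
  pose v n := t +i* u n - w.
  have vE n : v n = (0 +i* 1) * (u n - y)%:C.
    by apply: complex_ext; rewrite /v /w /= ?tx; ring.
  have v0 n : v n != 0.
    rewrite -nc_eq0 vE Normc.normcM nc_i mul1r nc_real normr_eq0 subr_eq0.
    exact: uy.
  have vy n : 2 * nc (v n) <= Im w by rewrite vE Normc.normcM nc_i mul1r nc_real.
  have vc : ccvg v 0.
    by rewrite -(subrr w); apply: ccvgB => //; exact: ccvg_cst.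
  have H := hd v0 vy vc.
  rewrite (_ : (fun _ => _) = fun n => (h (w + v n) - h w) / v n * (t +i* u n - conjc w)^-1).
    have -> : q (t +i* s) = d / (w - conjc w) by rewrite tx sy /q eqxx.
    apply: ccvgM => //; apply: ccvgV.
      by rewrite -nc_eq0 wwJ mulf_neq0// gt_eqF.
    by apply: ccvgB; [exact: tw|exact: ccvg_cst].
  apply/funext => n; rewrite /q; case: eqP => [E|_].
    by have := v0 n; rewrite /v E subrr eqxx.
  by rewrite /v subrKC invfM mulrA.
have [sp|] := ltP 0 s.
  have [e qe] := q_cderiv (sp : 0 < Im (t +i* s)) sw.
  exact: (cderiv_ccvg _ qe).
move=> s_le0; have s_eq0 : s = 0 by apply/le_anti/andP.
rewrite /q (negbTE sw).
have wJ0 : t +i* s - conjc w != 0.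
  by rewrite eq_complex /= s_eq0 sub0r opprK (gt_eqF y0) andbF.
apply: (@ccvg_near _ (fun n => (h (t +i* u n) - h w) /
    ((t +i* u n - w) * (t +i* u n - conjc w)))).
  apply: nearW => n; case: eqP => // -[_ E].
  by have := uy n; rewrite E eqxx.
apply: ccvgM.
  apply: ccvgB; last exact: ccvg_cst.
  by rewrite s_eq0 in tus *; apply: (bounded_holo_boundary hB).
apply: ccvgV; first by rewrite mulf_neq0// subr_eq0.
by apply: ccvgM; apply: ccvgB => //; exact: ccvg_cst.
Qed.

Let J (s : R) := cintegral setT (fun t => q (t +i* s)).

Let q_line_measurable (s : R) : 0 < s -> s != y -> cmeasurable setT (fun t => q (t +i* s)).
Proof.
move=> s0 sy; apply: cderiv_line_measurable => // t; apply: q_cderiv => //.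
by apply: contra sy => /eqP[_ ->].
Qed.

Let J_ccvg (s : R) (u : nat -> R) : 0 <= s -> u @ \oo --> s -> (forall n, 0 < u n) ->
  (forall n, u n != y) -> (forall n, 2 * `|u n - y| <= y) \/ s != y ->
  ccvg (J \o u) (J s).
Proof.
move=> s0 us u0 uy uc; have [K K0 qK] := q_le.
apply: (@cintegral_ccvg _ _ _ _ (fun t => K * poisson_kernel x y t)) => //.
- by move=> n; exact: q_line_measurable.
- by move=> t _; apply: q_ccvg => // n; exact: ltW.
- exact: (integrableZl _ K (integrable_poisson_kernel x y0)).
- by move=> n t _; apply: qK; exact: ltW.
Qed.

(** [q] is not known to be differentiable at [w], so lines are compared on one side of [y] only;
    [J_ccvg] then joins the two sides. *)
Let J_cst (b c : R) : 0 < b -> b < c -> c < y \/ y < b -> J b = J c.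
Proof.
move=> b0 bc ybc; have [K K0 qK] := q_le.
apply: (@line_integral_cst _ _ x y K) => // t s bs sc.
  apply: q_cderiv; first exact: lt_le_trans bs.
  by apply/eqP => -[_ E]; case: ybc; rewrite -E ltNge ?bs ?sc.
by apply: qK; exact: le_trans (ltW b0) bs.
Qed.

(** The denominator n + 2 keeps the factor at most 1/2: approximating lines then stay off [y], and
    their increments are admissible in [cderiv]. *)
Let cvg_inv2 : (fun n => n.+2%:R^-1 : R) @ \oo --> (0 : R).
Proof. by have := @cvg_harmonic R; rewrite -(cvg_shiftS (fun n => n.+1%:R^-1 : R)). Qed.

Let inv2_gt0 n : 0 < (n.+2%:R : R)^-1.
Proof. by rewrite invr_gt0 ltr0n. Qed.

Let inv2_le n : 2 * (n.+2%:R : R)^-1 <= 1.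
Proof. by rewrite ler_pdivrMr ?ltr0n// mul1r ler_nat. Qed.

Let inv2_lt1 n : (n.+2%:R : R)^-1 < 1.
Proof. by rewrite invf_lt1 ?ltr1n// ltr0n. Qed.

(** [J] does not change as the line moves up, while [q] tends to 0 pointwise under a fixed multiple
    of the kernel. *)
Let J_gt (s : R) : y < s -> J s = 0.
Proof.
move=> ys; have s0 := lt_trans y0 ys.
have E n : J s = J (s + n.+1%:R).
  by apply: J_cst => //; [rewrite ltrDl|right].
have [K K0 qK] := q_le.
have B0 := bounded_holo_ge0.
suff H : ccvg (fun n => J (s + n.+1%:R)) (cintegral setT (fun=> 0)).
  rewrite (@ccvg_uniq _ _ (J s) _ _ H); last first.
    by under eq_fun do rewrite -E; exact: ccvg_cst.
  by apply: complex_ext; rewrite /= Rintegral_cst//= mul0r.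
apply: (@cintegral_ccvg _ _ _ _ (fun t => K * poisson_kernel x y t)) => //.
- by move=> n; apply: q_line_measurable; rewrite ?gt_eqF ?ltr_wpDr.
- move=> t _; apply: (@squeeze_ccvg _ _ _ (fun n => 2 * B * n.+1%:R^-1)); last first.
    rewrite -(mulr0 (2 * B)); apply: cvgM; first exact: cvg_cst.
    exact: cvg_harmonic.
  move=> n; rewrite subr0.
  have n1 : 1 <= (n.+1%:R : R) by rewrite ler1n.
  have aP : n.+1%:R <= nc (t +i* (s + n.+1%:R) - w).
    have E1 : Im (t +i* (s + n.+1%:R) - w) = s + n.+1%:R - y by [].
    by apply: le_trans (Im_le_nc _); rewrite E1 ger0_norm; lra.
  have cP : 1 <= nc (t +i* (s + n.+1%:R) - conjc w).
    have E1 : Im (t +i* (s + n.+1%:R) - conjc w) = s + n.+1%:R + y.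
      by rewrite /w /= opprK.
    apply: le_trans (Im_le_nc _); rewrite E1; apply: le_trans (ler_norm _).
    by rewrite -addrA ler_wpDl ?(ltW s0)// ler_wpDr ?(ltW y0).
  rewrite /q; case: eqP => [E1|_].
    by move: aP; rewrite E1 subrr nc0 => /(le_trans n1); rewrite ler10.
  rewrite nc_div Normc.normcM; apply: ler_pM; rewrite ?nc_ge0 ?invr_ge0 ?mulr_ge0 ?nc_ge0//.
    have := ncB (h (t +i* (s + n.+1%:R))) (h w).
    have := bounded_holo_le hB (ltW y0 : 0 <= Im w).
    have : 0 <= Im (t +i* (s + n.+1%:R)) by rewrite /= addr_ge0// ltW.
    by move=> /(bounded_holo_le hB); lra.
  rewrite lef_pV2 ?posrE ?ltr0n//; last first.
    by rewrite mulr_gt0//; [apply: lt_le_trans aP|apply: lt_le_trans cP]; rewrite ?ltr0n.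
  by rewrite -[X in X <= _]mulr1; apply: ler_pM.
- exact: (integrableZl _ K (integrable_poisson_kernel x y0)).
- by move=> n t _; apply: qK; rewrite addr_ge0// ltW.
Qed.

Let J_eq : J y = 0.
Proof.
have H : ccvg (J \o (fun n => y + y * n.+2%:R^-1)) (J y).
  apply: J_ccvg => [|||n|]; first exact: ltW.
  - rewrite -[X in _ --> X]addr0 -[in X in _ + X](mulr0 y).
    by apply: cvgD; [exact: cvg_cst|apply: cvgM => //; exact: cvg_cst].
  - by move=> n; rewrite addr_gt0// mulr_gt0.
  - by rewrite gt_eqF// ltrDl mulr_gt0.
  - left=> n; rewrite addrC addKr ger0_norm ?mulr_ge0 ?(ltW y0) ?(ltW (inv2_gt0 n))//.
    by rewrite mulrCA ler_piMr ?(ltW y0)// inv2_le.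
apply: (ccvg_uniq H); rewrite (_ : J \o _ = fun=> 0); first exact: ccvg_cst.
by apply/funext => n /=; rewrite J_gt// ltrDl mulr_gt0.
Qed.

(** [J] is constant below [y], and its limit at [y] is [J y = 0]. *)
Let J_lt (s : R) : 0 < s -> s < y -> J s = 0.
Proof.
move=> s0 sy; rewrite -J_eq; pose u n := y - (y - s) * n.+2%:R^-1.
have ys : 0 < y - s by rewrite subr_gt0.
have us n : s < u n.
  rewrite /u ltrBrDr addrC -ltrBrDr gtr_pMr//.
have uy n : u n < y by rewrite /u gtrDl oppr_lt0 mulr_gt0.
have H : ccvg (J \o u) (J y).
  apply: J_ccvg => [|||n|]; first exact: ltW.
  - rewrite -[X in _ --> X]subr0 -[in X in _ - X](mulr0 (y - s)).
    by apply: cvgB; [exact: cvg_cst|apply: cvgM => //; exact: cvg_cst].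
  - by move=> n; exact: lt_trans (us n).
  - by rewrite lt_eqF.
  - left=> n; rewrite distrC ger0_norm ?subr_ge0 ?(ltW (uy n))// /u.
    rewrite opprB addrC subrK mulrCA; apply: (@le_trans _ _ (y - s)).
      by rewrite ler_piMr ?(ltW ys)// inv2_le.
    by rewrite gerBl ltW.
apply/esym; apply: (ccvg_uniq H); rewrite (_ : J \o u = fun=> J s); first exact: ccvg_cst.
by apply/funext => n /=; rewrite (@J_cst s (u n))//; left.
Qed.

Let J0 : J 0 = 0.
Proof.
have H : ccvg (J \o (fun n => y * n.+2%:R^-1)) (J 0).
  apply: J_ccvg => [|||n|] //.
  - by rewrite -(mulr0 y); apply: cvgM => //; exact: cvg_cst.
  - by move=> n; rewrite mulr_gt0.
  - by rewrite lt_eqF// gtr_pMr// inv2_lt1.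
  - by right; rewrite lt_eqF.
apply: (ccvg_uniq H); rewrite (_ : J \o _ = fun=> 0); first exact: ccvg_cst.
apply/funext => n /=; rewrite J_lt// ?mulr_gt0//.
by rewrite gtr_pMr// inv2_lt1.
Qed.

Let boundary_measurable : cmeasurable setT (fun t : R => h t%:C).
Proof.
apply: (@cmeasurable_ccvg _ _ (fun n t => h (t +i* n.+1%:R^-1))) => [n|t _].
  apply: cderiv_line_measurable; first by rewrite invr_gt0 ltr0n.
  by move=> t; apply: (bounded_holo_cderiv hB); rewrite /= invr_gt0 ltr0n.
apply: (bounded_holo_boundary hB) => [n|]; first by rewrite /= invr_ge0 ler0n.
by apply: ccvg_complex; [exact: cvg_cst|exact: cvg_harmonic].
Qed.

Lemma boundary_kernel_integrable :
  cintegrable setT (fun t : R => h t%:C * (poisson_kernel x y t)%:C).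
Proof.
apply: (@dominated_cintegrable _ _ _ (fun t => B * poisson_kernel x y t)) => //.
- apply: cmeasurableM => //; apply: cmeasurable_real; apply: continuous_measurable_fun.
  exact: continuous_poisson_kernel.
- exact: (integrableZl _ B (integrable_poisson_kernel x y0)).
- move=> t _; rewrite Normc.normcM nc_real ger0_norm ?poisson_kernel_ge0//.
  by rewrite ler_wpM2r ?poisson_kernel_ge0// (bounded_holo_le hB).
Qed.

Lemma poisson_formula_cderiv :
  cintegral setT (fun t : R => h t%:C * (poisson_kernel x y t)%:C) = pi%:C * h (x +i* y).
Proof.
have ik := boundary_kernel_integrable.
have ic : cintegrable setT (fun t : R => h w * (poisson_kernel x y t)%:C).
  apply: cintegrableZl => //; split; first exact: integrable_poisson_kernel.
  exact: integrable0.
(* For real t, (t - w)(t - conj w) is the denominator of the kernel, so y q(t) is (h(t) - h(w))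
   times the kernel, and [J0] becomes Poisson's formula. *)
have /eqP : cintegral setT (fun t => y%:C * q (t +i* 0)) = 0.
  rewrite cintegralZl// ?[X in _ * X]J0 ?mulr0//.
  have [K K0 qK] := q_le.
  apply: (@dominated_cintegrable _ _ _ (fun t => K * poisson_kernel x y t)) => //.
  - apply: (@cmeasurable_ccvg _ _ (fun n t => q (t +i* (y * n.+2%:R^-1)))) => [n|t _].
      by apply: q_line_measurable; rewrite ?mulr_gt0// lt_eqF// gtr_pMr// inv2_lt1.
    apply: q_ccvg => // [|n|n|]; last by right; rewrite lt_eqF.
    + by rewrite -(mulr0 y); apply: cvgM => //; exact: cvg_cst.
    + by rewrite mulr_ge0 ?ltW.
    + by rewrite lt_eqF// gtr_pMr// inv2_lt1.
  - exact: (integrableZl _ K (integrable_poisson_kernel x y0)).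
  - by move=> t _; exact: qK.
rewrite (@eq_cintegral _ _ _ (fun t : R => h t%:C * (poisson_kernel x y t)%:C -
    h w * (poisson_kernel x y t)%:C)); last first.
  move=> t _; rewrite /q; case: eqP => [[_ y00]|_].
    by move: y0; rewrite -y00 ltxx.
  have -> : (t +i* 0 - w) * (t +i* 0 - conjc w) = ((t - x) ^+ 2 + y ^+ 2)%:C.
    by apply: complex_ext; rewrite /w /=; ring.
  rewrite /poisson_kernel -mulrBl rmorphM/= fmorphV/=; ring.
rewrite cintegralB// subr_eq0 => /eqP ->.
rewrite cintegralZl//; last first.
  by split; [exact: integrable_poisson_kernel|exact: integrable0].
rewrite mulrC; congr (_ * _); apply: complex_ext => /=.
  exact: Rintegral_poisson_kernel.
by rewrite Rintegral_cst//= mul0r.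
Qed.

End Pole.

Theorem poisson_formula (x y : R) : 0 < y ->
  cintegral setT (fun t : R => h t%:C * (poisson_kernel x y t)%:C) = pi%:C * h (x +i* y).
Proof.
move=> y0; have [d hd] := bounded_holo_cderiv hB (y0 : 0 < Im (x +i* y)).
exact: poisson_formula_cderiv hd.
Qed.

(* [poisson_kernel x y t] is the imaginary part of [1 / (t - w)] for [w = x + i y] *)
Lemma poisson_kernel_lip (x y x' y' t : R) : 0 < y ->
  2 * nc (x' +i* y' - x +i* y) <= y ->
  `|poisson_kernel x' y' t - poisson_kernel x y t| <=
    2 / y * nc (x' +i* y' - x +i* y) * poisson_kernel x y t.
Proof.
move=> y0; set w := x +i* y; set w' := x' +i* y'; set e := nc _ => ey.
have y'0 : 0 < y'.
  have := Im_le_nc (w' - w); rewrite -/e ler_norml /= => /andP[]; lra.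
pose z := t%:C - w; pose z' := t%:C - w'.
have ImV (a b : R) : poisson_kernel a b t = Im (t%:C - a +i* b)^-1.
  by rewrite /poisson_kernel /= sub0r sqrrN mulNr opprK.
have yz : y <= nc z.
  apply: le_trans (Im_le_nc z); rewrite /= sub0r normrN; exact: ler_norm.
have z0 : 0 < nc z by exact: lt_le_trans yz.
(* Moving [w] by at most [y / 2 <= nc z / 2] keeps at least half of its distance to [t]. *)
have zz' : nc z <= 2 * nc z'.
  have := nc_subl z (w' - w).
  rewrite (_ : z - (w' - w) = z'); first by rewrite -/e; lra.
  by rewrite /z /z'; ring.
have z'0 : 0 < nc z' by lra.
have z2 : poisson_kernel x y t = y / nc z ^+ 2.
  by rewrite /poisson_kernel nc_sqr /= sub0r sqrrN.
rewrite [X in _ <= _ * X]z2 !ImV -/z -/z' -ImN -ImD.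
apply: le_trans (Im_le_nc _) _.
rewrite (_ : z'^-1 - z^-1 = (w' - w) / (z' * z)); last first.
  by rewrite (_ : w' - w = z - z'); [field; rewrite -!nc_gt0 z0 z'0|rewrite /z /z'; ring].
rewrite nc_div -/e (_ : 2 / y * e * (y / nc z ^+ 2) = e * (2 / (nc z * nc z))); last first.
  by field; rewrite !gt_eqF.
apply: ler_wpM2l; first exact: nc_ge0.
rewrite Normc.normcM ler_pdivlMr ?mulr_gt0// mulrC ler_pdivrMr ?mulr_gt0//.
by rewrite mulrA ler_pM2r.
Qed.

(** A Cauchy estimate drawn from Poisson's formula: the bound on the kernel's variation integrates
    to 2 pi |v| / Im w, and [nc_cintegral_le] doubles it. The constant involves [h] only through
    [B], hence is uniform over functions with a common bound. *)
Theorem bounded_holo_lip (w v : R[i]) : 0 < Im w -> 2 * nc v <= Im w ->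
  nc (h (w + v) - h w) <= 4 * B / Im w * nc v.
Proof.
case: w => x y /= y0 vy; have B0 := bounded_holo_ge0.
pose w := x +i* y; pose x' := Re (w + v); pose y' := Im (w + v).
have w'E : w + v = x' +i* y' by apply: complex_ext.
have dw : x' +i* y' - x +i* y = v by rewrite -w'E addrC addKr.
have y'0 : 0 < y'.
  have := Im_le_nc v; rewrite ler_norml /y' ImD /= => /andP[]; lra.
rewrite -/w w'E -(@ler_pM2l _ pi) ?pi_gt0//.
have -> : pi * nc (h (x' +i* y') - h w) = nc (pi%:C * h (x' +i* y') - pi%:C * h w).
  by rewrite -mulrBr Normc.normcM nc_real ger0_norm// pi_ge0.
have ik := boundary_kernel_integrable x y0.
have ik' := boundary_kernel_integrable x' y'0.
rewrite -!poisson_formula// -cintegralB//.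
have ip := integrableZl _ (B * (2 / y * nc v)) (integrable_poisson_kernel x y0).
apply: (le_trans (nc_cintegral_le (k := fun t => B * (2 / y * nc v) * poisson_kernel x y t) _ _ _ _)) => //.
- exact: cintegrable_measurable (cintegrableB _ ik' ik).
- exact: ip.
- move=> t _; rewrite -mulrBr Normc.normcM -mulrA.
  have -> : nc ((poisson_kernel x' y' t)%:C - (poisson_kernel x y t)%:C) =
      `|poisson_kernel x' y' t - poisson_kernel x y t| by rewrite -nc_real rmorphB.
  apply: ler_pM; rewrite ?nc_ge0//.
    exact: (bounded_holo_le hB).
  by have := @poisson_kernel_lip x y x' y' t y0; rewrite dw; exact.
rewrite RintegralZl//; last exact: integrable_poisson_kernel.
rewrite Rintegral_poisson_kernel// le_eqVlt; apply/orP; left; apply/eqP.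
by field; rewrite gt_eqF.
Qed.

End PoissonFormula.

(** * First-order systems with bounded measurable coefficients *)

Section Primitives.
Context {R : realType}.
Local Notation mu := (@lebesgue_measure R).
Variable a : R.
Implicit Types (f g F G : R -> R[i]) (x y t : R).

Definition bounded_measurable f := cmeasurable `[0, a] f /\
  exists K : R, forall x, 0 <= x -> x <= a -> nc (f x) <= K.

(** The equation F' = f in integrated form, since for a measurable [f] it may fail at some
    points. *)
Definition primitive F f := forall x, 0 <= x -> x <= a ->
  F x = F 0 + cintegral `[0, x] f.

Lemma bounded_measurable_cst (z : R[i]) : bounded_measurable (fun=> z).
Proof. by split; [exact: cmeasurable_cst|exists (nc z)]. Qed.

Lemma bounded_measurableD f g : bounded_measurable f -> bounded_measurable g ->
  bounded_measurable (fun x => f x + g x).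
Proof.
move=> [fm [K fK]] [gm [L gL]]; split; first exact: cmeasurableD.
by exists (K + L) => x x0 xa; apply: le_trans (le_normcD _ _) _; apply: lerD; auto.
Qed.

Lemma bounded_measurableM f g : bounded_measurable f -> bounded_measurable g ->
  bounded_measurable (fun x => f x * g x).
Proof.
move=> [fm [K fK]] [gm [L gL]]; split; first exact: cmeasurableM.
exists (K * L) => x x0 xa; rewrite Normc.normcM.
by apply: ler_pM; rewrite ?nc_ge0; auto.
Qed.

Lemma bounded_measurableN f : bounded_measurable f ->
  bounded_measurable (fun x => - f x).
Proof.
move=> [fm [K fK]]; split; first exact: cmeasurableN.
by exists K => x x0 xa; rewrite normcN; auto.
Qed.

Lemma bounded_measurableB f g : bounded_measurable f -> bounded_measurable g ->
  bounded_measurable (fun x => f x - g x).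
Proof. by move=> fb gb; apply: bounded_measurableD => //; exact: bounded_measurableN. Qed.

Lemma bounded_measurableJ f : bounded_measurable f ->
  bounded_measurable (fun x => conjc (f x)).
Proof.
move=> [fm [K fK]]; split; first exact: cmeasurableJ.
by exists K => x x0 xa; rewrite ncJ; auto.
Qed.

Lemma bounded_measurable_integrable f x y : 0 <= x -> y <= a ->
  bounded_measurable f -> cintegrable `[x, y] f.
Proof.
move=> x0 ya [fm [K fK]]; have sub : `[x, y]%classic `<=` `[0, a]%classic.
  by apply: subset_itv; rewrite bnd_simp.
apply: (@bounded_cintegrable _ _ _ _ K); first exact: cmeasurableS sub fm.
by move=> t /sub; rewrite /= in_itv/= => /andP[]; exact: fK.
Qed.

Lemma primitiveB F f x y : bounded_measurable f -> primitive F f ->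
  0 <= x -> x <= y -> y <= a -> F y - F x = cintegral `[x, y] f.
Proof.
move=> fb Ff x0 xy ya; rewrite (Ff y) ?(le_trans x0)// (Ff x) ?(le_trans xy)//.
rewrite (@cintegral_itv_split _ 0 x y)//; last exact: bounded_measurable_integrable.
ring.
Qed.

Lemma primitive_lip F f : bounded_measurable f -> primitive F f ->
  exists2 K, 0 <= K & forall x y, 0 <= x -> x <= y -> y <= a ->
    nc (F y - F x) <= K * (y - x).
Proof.
move=> fb Ff; have [fm [K fK]] := fb; exists (2 * `|K|); first by rewrite mulr_ge0.
move=> x y x0 xy ya; rewrite (primitiveB fb Ff)//; apply: nc_cintegral_itv => //.
  exact: cintegrable_measurable (bounded_measurable_integrable x0 ya fb).
move=> t /=; rewrite in_itv/= => /andP[xt ty].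
by apply: le_trans (ler_norm K); apply: fK; [exact: le_trans xt|exact: le_trans ya].
Qed.

(** Over n + 1 equal steps the increments add up to at most K x^2 / (n + 1). This stands in for a
    vanishing derivative in the product rule. *)
Lemma quadratic_increments_cst (D : R -> R[i]) (K : R) :
  (forall x y, 0 <= x -> x <= y -> y <= a -> nc (D y - D x) <= K * (y - x) ^+ 2) ->
  forall x, 0 <= x -> x <= a -> D x = D 0.
Proof.
move=> DK x x0 xa; apply/eqP; rewrite -subr_eq0 -nc_eq0.
have H (n : nat) : nc (D x - D 0) <= K * x ^+ 2 * n.+1%:R^-1.
  pose e := x / n.+1%:R.
  have n0 : 0 < n.+1%:R :> R by rewrite ltr0n.
  have e0 : 0 <= e by rewrite divr_ge0// ltW.
  have ne : n.+1%:R * e = x by rewrite mulrC divfK// gt_eqF.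
  have IH k : (k <= n.+1)%N -> nc (D (k%:R * e) - D 0) <= k%:R * (K * e ^+ 2).
    elim: k => [|k IH] kn; first by rewrite !mul0r subrr nc0.
    apply: le_trans (nc_triB _ _ (D (k%:R * e))) _.
    rewrite -natr1 mulrDl mul1r addrC [X in _ <= X]mulrDl mul1r.
    apply: lerD; first exact: IH (ltnW kn).
    have -> : K * e ^+ 2 = K * (k%:R * e + e - k%:R * e) ^+ 2.
      by rewrite addrC addKr.
    apply: DK; rewrite ?mulr_ge0 ?lerDl//.
    rewrite (@le_trans _ _ (n.+1%:R * e)) ?ne// -ne.
    by rewrite -[X in _ + X]mul1r -mulrDl natr1 ler_wpM2r// ler_nat.
  have := IH _ (leqnn _); rewrite ne => /le_trans; apply.
  by rewrite le_eqVlt /e; apply/orP; left; apply/eqP; field; rewrite gt_eqF.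
rewrite eq_le nc_ge0 andbT.
have lim : (fun n => K * x ^+ 2 * n.+1%:R^-1) @ \oo --> (0 : R).
  by rewrite -(mulr0 (K * x ^+ 2)); apply: cvgM; [exact: cvg_cst|exact: cvg_harmonic].
exact: (ler_cvg_to (cvg_cst (nc (D x - D 0))) lim (nearW _ H)).
Qed.

(* The increment of [F G - int (f G + F g)] over [x, y] is
   [int (f (G y - G) + (F x - F) g)], which is quadratic in [y - x]. *)
Lemma primitiveM F f G g :
  bounded_measurable F -> bounded_measurable f -> primitive F f ->
  bounded_measurable G -> bounded_measurable g -> primitive G g ->
  primitive (fun x => F x * G x) (fun x => f x * G x + F x * g x).
Proof.
move=> Fb fb Ff Gb gb Gg.
have [KF KF0 FK] := primitive_lip fb Ff; have [KG KG0 GK] := primitive_lip gb Gg.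
have [fm [Kf fK]] := fb; have [gm [Kg gK]] := gb.
pose k x := f x * G x + F x * g x.
have kb : bounded_measurable k.
  by apply: bounded_measurableD; exact: bounded_measurableM.
pose D x := F x * G x - cintegral `[0, x] k.
have H x y : 0 <= x -> x <= y -> y <= a ->
    nc (D y - D x) <= 2 * (`|Kf| * KG + KF * `|Kg|) * (y - x) ^+ 2.
  move=> x0 xy ya; have y0 := le_trans x0 xy; have xa := le_trans xy ya.
  pose l t := f t * (G y - G t) + (F x - F t) * g t.
  have lb : bounded_measurable l.
    by apply: bounded_measurableD; apply: bounded_measurableM => //;
      apply: bounded_measurableB => //; exact: bounded_measurable_cst.
  have bi := bounded_measurable_integrable x0 ya.
  have -> : D y - D x = cintegral `[x, y] l.
    rewrite /D (@cintegral_itv_split _ 0 x y)//; last exact: bounded_measurable_integrable.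
    have -> : F y * G y - (cintegral `[0, x] k + cintegral `[x, y] k) -
        (F x * G x - cintegral `[0, x] k) =
        (G y * (F y - F x) + F x * (G y - G x)) - cintegral `[x, y] k by ring.
    rewrite (primitiveB fb Ff)// (primitiveB gb Gg)// -!cintegralZl//; try exact: bi.
    rewrite -cintegralD// -?cintegralB//; try (apply: cintegrableZl => //; exact: bi).
    - by apply: eq_cintegral => t _; rewrite /l /k; ring.
    - by apply: cintegrableD => //; apply: cintegrableZl => //; exact: bi.
    - exact: bi.
  rewrite expr2 mulrA -(mulrA 2); apply: nc_cintegral_itv => //.
    exact: cintegrable_measurable (bi _ lb).
  move=> t /=; rewrite in_itv/= => /andP[xt ty].
  have t0 := le_trans x0 xt; have ta := le_trans ty ya.
  rewrite mulrDl; apply: le_trans (le_normcD _ _) _; rewrite !Normc.normcM.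
  apply: lerD.
    rewrite -mulrA; apply: ler_pM; rewrite ?nc_ge0//.
      by apply: le_trans (ler_norm _); exact: fK.
    apply: le_trans (GK _ _ _ _ _) _ => //; rewrite ler_wpM2l// lerD2l lerN2 //.
  rewrite mulrAC; apply: ler_pM; rewrite ?nc_ge0//.
    rewrite ncBC; apply: le_trans (FK _ _ _ _ _) _ => //.
    by rewrite ler_wpM2l// lerD2r.
  by apply: le_trans (ler_norm _); exact: gK.
move=> x x0 xa; have := quadratic_increments_cst H x0 xa.
rewrite /D cintegral_point subr0 => /eqP; rewrite subr_eq => /eqP ->.
by rewrite addrC.
Qed.

Lemma primitive_sub F f G g : bounded_measurable f -> bounded_measurable g ->
  primitive F f -> primitive G g ->
  primitive (fun x => F x - G x) (fun x => f x - g x).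
Proof.
move=> fb gb Ff Gg x x0 xa; rewrite (Ff x)// (Gg x)// cintegralB//; try exact: bounded_measurable_integrable.
ring.
Qed.

Lemma primitive_lin F f G g (c d : R[i]) : bounded_measurable f -> bounded_measurable g ->
  primitive F f -> primitive G g ->
  primitive (fun x => c * F x + d * G x) (fun x => c * f x + d * g x).
Proof.
move=> fb gb Ff Gg x x0 xa.
have fi : cintegrable `[0, x] f by exact: bounded_measurable_integrable.
have gi : cintegrable `[0, x] g by exact: bounded_measurable_integrable.
rewrite (Ff x)// (Gg x)// cintegralD ?cintegralZl//; try exact: cintegrableZl.
ring.
Qed.

Lemma primitiveJ F f : bounded_measurable f -> primitive F f ->
  primitive (fun x => conjc (F x)) (fun x => conjc (f x)).
Proof.
move=> fb Ff x x0 xa; rewrite (Ff x)// rmorphD/= cintegralJ//.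
exact: bounded_measurable_integrable.
Qed.

End Primitives.

Section System.
Context {R : realType}.
Local Notation mu := (@lebesgue_measure R).
Variable a : R.
Implicit Types (alpha beta v p : R -> R[i]).

Lemma Rintegral_expR (l x : R) : 0 < l -> 0 <= x ->
  \int[mu]_(t in `[0, x]) expR (l * t) <= expR (l * x) / l.
Proof.
move=> l0; rewrite le_eqVlt => /predU1P[<-|x0].
  by rewrite set_itv1 Rintegral_set1 divr_ge0 ?expR_ge0// ltW.
pose F t := l^-1 * expR (l * t).
have dF (t : R) : is_derive t 1 F (expR (l * t)).
  have H : is_derive t 1 (fun t : R => l *: t) l.
    by apply: is_derive_eq; exact: mulr1.
  apply: is_derive_eq (is_deriveZ l^-1 (is_derive1_comp (is_derive_expR (l * t)) H)) _.
  rewrite /GRing.scale/=; field.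
  by rewrite gt_eqF.
rewrite /Rintegral (@continuous_FTC2 _ _ F)//.
- rewrite -EFinB /= /F mulr0 expR0 mulr1 mulrC lerBlDr lerDl invr_ge0.
  exact: ltW.
- apply: continuous_subspaceT => t.
  apply: (@continuous_comp _ _ _ (fun t => l * t) expR); last exact: continuous_expR.
  by apply: mulrl_continuous.
- have cF t : F @ t --> F t.
    by apply: differentiable_continuous; apply/derivable1_diffP.
  split; [by move=> t _|exact: cvg_at_right_filter|exact: cvg_at_left_filter].
- by move=> t _; rewrite derive1E derive_val.
Qed.

(** The system v' = alpha p, p' = beta v. For the slab, [alpha] is i w C' and [beta] is i w rho';
    keeping them abstract lets one Wronskian identity compare two frequencies, or a system and a
    conjugated one. *)
Record solution alpha beta v p : Prop := Solution {
  sol_alpha : bounded_measurable a alpha ;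
  sol_beta : bounded_measurable a beta ;
  sol_v : bounded_measurable a v ;
  sol_p : bounded_measurable a p ;
  sol_primitive_v : primitive a v (fun x => alpha x * p x) ;
  sol_primitive_p : primitive a p (fun x => beta x * v x) }.

(* A bound [S] for [(|v| + |p|) exp (- 8 L x)] improves to [m0 + S / 2]; iterate. *)
Lemma gronwall alpha beta v p (L : R) : 0 < L -> 0 <= a ->
  (forall x, 0 <= x -> x <= a -> nc (alpha x) <= L /\ nc (beta x) <= L) ->
  solution alpha beta v p ->
  forall x, 0 <= x -> x <= a ->
    nc (v x) + nc (p x) <= 2 * (nc (v 0) + nc (p 0)) * expR (8 * L * a).
Proof.
move=> L0 a0 abL [alb beb vb pb vP pP].
(* With l = 8 L, twice the integral of L S exp (l t) is at most S exp (l x) / 4, so the two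
   components together contribute S / 2. *)
pose m0 := nc (v 0) + nc (p 0); pose l := 8 * L.
have l0 : 0 < l by rewrite mulr_gt0.
have m00 : 0 <= m0 by rewrite addr_ge0 ?nc_ge0.
have e1 t : 0 <= t -> 1 <= expR (l * t).
  by move=> t0; rewrite -expR0 ler_expR mulr_ge0// ltW.
have [_ [Kv vK]] := vb; have [_ [Kp pK]] := pb; pose K := Kv + Kp.
have K0 : 0 <= K.
  apply: addr_ge0; [apply: le_trans (vK 0 _ _)|apply: le_trans (pK 0 _ _)];
  by rewrite ?nc_ge0.
have ik (x c : R) : mu.-integrable `[0, x] (EFin \o (fun t => c * expR (l * t))).
  apply: continuous_compact_integrable; first exact: segment_compact.
  apply: continuous_subspaceT => t; apply: cvgM; first exact: cvg_cst.
  apply: (@continuous_comp _ _ _ (fun t => l * t) expR); last exact: continuous_expR.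
  exact: mulrl_continuous.
have step (u w f : R -> R[i]) (S : R) : 0 <= S -> bounded_measurable a f ->
    bounded_measurable a w ->
    primitive a u (fun x => f x * w x) ->
    (forall t, 0 <= t -> t <= a -> nc (f t) <= L) ->
    (forall t, 0 <= t -> t <= a -> nc (w t) <= S * expR (l * t)) ->
    forall x, 0 <= x -> x <= a -> nc (u x) <= nc (u 0) + S / 4 * expR (l * x).
  move=> S0 fb wb uP fL wS x x0 xa; rewrite (uP x)//.
  apply: le_trans (le_normcD _ _) _; rewrite lerD2l.
  apply: (le_trans (nc_cintegral_le (k := fun t => L * S * expR (l * t)) _ _ _ _)) => //.
  - apply: cintegrable_measurable.
    by apply: (bounded_measurable_integrable _ xa); [|exact: bounded_measurableM].
  - move=> t /=; rewrite in_itv/= => /andP[t0 tx]; rewrite Normc.normcM -mulrA.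
    by apply: ler_pM; rewrite ?nc_ge0 ?fL ?wS//; exact: le_trans xa.
  rewrite RintegralZl//; last first.
    by apply: eq_integrable (ik x 1) => // t _ /=; rewrite mul1r.
  have := Rintegral_expR l0 x0; set I := Rintegral _ _ _ => HI.
  apply: (@le_trans _ _ (2 * (L * S * (expR (l * x) / l)))).
    by rewrite ler_pM2l// ler_wpM2l// mulr_ge0// ltW.
  by rewrite le_eqVlt /l; apply/orP; left; apply/eqP; field; rewrite gt_eqF.
(* The a priori bound [K] starts the iteration, and 2 m0 is the fixed point of S -> m0 + S / 2. *)
have H n x : 0 <= x -> x <= a ->
    nc (v x) + nc (p x) <= (2 * m0 + K * 2^-1 ^+ n) * expR (l * x).
  elim: n x => [|n IH] x x0 xa.
    rewrite expr0 mulr1; apply: (@le_trans _ _ K).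
      by apply: lerD; [exact: vK|exact: pK].
    apply: (@le_trans _ _ (2 * m0 + K)); first by rewrite lerDr mulr_ge0.
    by rewrite ler_peMr ?e1// addr_ge0// mulr_ge0.
  set S := 2 * m0 + K * 2^-1 ^+ n in IH.
  have S0 : 0 <= S by rewrite addr_ge0 ?mulr_ge0// exprn_ge0.
  have Sv t : 0 <= t -> t <= a -> nc (v t) <= S * expR (l * t).
    by move=> t0 ta; apply: le_trans (IH t t0 ta); rewrite lerDl nc_ge0.
  have Sp t : 0 <= t -> t <= a -> nc (p t) <= S * expR (l * t).
    by move=> t0 ta; apply: le_trans (IH t t0 ta); rewrite lerDr nc_ge0.
  have Hv := step v p alpha S S0 alb pb vP (fun t t0 ta => (abL t t0 ta).1) Sp x x0 xa.
  have Hp := step p v beta S S0 beb vb pP (fun t t0 ta => (abL t t0 ta).2) Sv x x0 xa.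
  apply: (@le_trans _ _ (m0 + S / 2 * expR (l * x))); first by rewrite /m0; lra.
  have -> : 2 * m0 + K * 2^-1 ^+ n.+1 = m0 + S / 2 by rewrite /S exprSr; field.
  by rewrite [X in _ <= X]mulrDl lerD2r ler_peMr// e1.
move=> x x0 xa.
have geo : (fun n => K * 2^-1 ^+ n) @ \oo --> (0 : R).
  by apply: (@cvg_geometric R K 2^-1); rewrite ger0_norm ?invf_lt1 ?ltr1n.
have lim : (fun n => (2 * m0 + K * 2^-1 ^+ n) * expR (l * x)) @ \oo -->
    ((2 * m0 + 0) * expR (l * x)).
  by apply: cvgM (cvg_cst _); apply: cvgD geo; exact: cvg_cst.
rewrite addr0 in lim.
have lim_le : nc (v x) + nc (p x) <= 2 * m0 * expR (l * x).
  exact: (ler_cvg_to (cvg_cst _) lim (nearW _ (fun n => H n x x0 xa))).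
apply: le_trans lim_le _; rewrite ler_wpM2l ?mulr_ge0// ler_expR /l.
by rewrite ler_wpM2l// mulr_ge0// ltW.
Qed.

(** In the derivative of v p' - p v' only differences of coefficients survive. Equal coefficients
    give the determinant and uniqueness; two frequencies give Duhamel's formula. *)
Lemma wronskian alpha beta v p alpha' beta' v' p' :
  solution alpha beta v p -> solution alpha' beta' v' p' ->
  forall x, 0 <= x -> x <= a ->
    v x * p' x - p x * v' x = v 0 * p' 0 - p 0 * v' 0 +
      cintegral `[0, x] (fun t => (alpha t - alpha' t) * (p t * p' t) -
                                  (beta t - beta' t) * (v t * v' t)).
Proof.
move=> [alb beb vb pb vP pP] [alb' beb' vb' pb' vP' pP'] x x0 xa.
have bM := bounded_measurableM; have bD := bounded_measurableD.
have H1 := primitiveM vb (bM _ _ _ _ alb pb) vP pb' (bM _ _ _ _ beb' vb') pP'.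
have H2 := primitiveM pb (bM _ _ _ _ beb vb) pP vb' (bM _ _ _ _ alb' pb') vP'.
have H := primitive_sub _ _ H1 H2; rewrite (H _ _ x x0 xa).
- by congr (_ + _); apply: eq_cintegral => t _; ring.
- exact: bD _ _ _ _ (bM _ _ _ _ (bM _ _ _ _ alb pb) pb') (bM _ _ _ _ vb (bM _ _ _ _ beb' vb')).
- exact: bD _ _ _ _ (bM _ _ _ _ (bM _ _ _ _ beb vb) vb') (bM _ _ _ _ pb (bM _ _ _ _ alb' pb')).
Qed.

Lemma solution_lin alpha beta v p v' p' (c d : R[i]) :
  solution alpha beta v p -> solution alpha beta v' p' ->
  solution alpha beta (fun x => c * v x + d * v' x) (fun x => c * p x + d * p' x).
Proof.
move=> [alb beb vb pb vP pP] [_ _ vb' pb' vP' pP'].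
have lin u u' : bounded_measurable a u -> bounded_measurable a u' ->
    bounded_measurable a (fun x => c * u x + d * u' x).
  by move=> ub ub'; apply: bounded_measurableD; apply: bounded_measurableM => //;
    exact: bounded_measurable_cst.
split => //; try exact: lin.
- have := primitive_lin c d (bounded_measurableM alb pb) (bounded_measurableM alb pb') vP vP'.
  by congr primitive; apply/funext => x; ring.
- have := primitive_lin c d (bounded_measurableM beb vb) (bounded_measurableM beb vb') pP pP'.
  by congr primitive; apply/funext => x; ring.
Qed.

Lemma solutionJ alpha beta v p : solution alpha beta v p ->
  solution (fun x => conjc (alpha x)) (fun x => conjc (beta x))
    (fun x => conjc (v x)) (fun x => conjc (p x)).
Proof.
move=> [alb beb vb pb vP pP]; split; try exact: bounded_measurableJ.
- have := primitiveJ (bounded_measurableM alb pb) vP.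
  by congr primitive; apply/funext => x; rewrite rmorphM.
- have := primitiveJ (bounded_measurableM beb vb) pP.
  by congr primitive; apply/funext => x; rewrite rmorphM.
Qed.

(* [Re (v conj p)] is the energy flux through the slab. *)
Lemma flux_nonincreasing alpha beta v p : 0 <= a -> solution alpha beta v p ->
  (forall x, 0 <= x -> x <= a -> Re (alpha x) <= 0 /\ Re (beta x) <= 0) ->
  Re (v a * conjc (p a)) <= Re (v 0 * conjc (p 0)).
Proof.
move=> a0 [alb beb vb pb vP pP] neg.
have bM := bounded_measurableM; have bJ := bounded_measurableJ.
have pJ := primitiveJ (bM _ _ _ _ beb vb) pP.
have H := primitiveM vb (bM _ _ _ _ alb pb) vP (bJ _ _ _ pb) (bJ _ _ _ (bM _ _ _ _ beb vb)) pJ.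
rewrite (H a a0 (lexx a)) ReD gerDl /=.
rewrite -oppr_ge0 -mulN1r -RintegralZl//; last first.
  have [] : cintegrable `[0, a] (fun x => alpha x * p x * (p x)^*%C + v x * (beta x * v x)^*%C).
    apply: (bounded_measurable_integrable (a := a)) => //.
    by apply: bounded_measurableD; [exact: bM _ _ _ _ (bM _ _ _ _ alb pb) (bJ _ _ _ pb)|
      exact: bM _ _ _ _ vb (bJ _ _ _ (bM _ _ _ _ beb vb))].
  by [].
apply: Rintegral_ge0 => x /=; rewrite in_itv/= => /andP[x0 xa].
have [al be] := neg x x0 xa.
(* The derivative of v conj p combines |p|^2 and |v|^2 with coefficients of nonpositive real
   part. *)
have -> : alpha x * p x * (p x)^*%C + v x * (beta x * v x)^*%C =
    alpha x * (nc (p x) ^+ 2)%:C + conjc (beta x) * (nc (v x) ^+ 2)%:C.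
  by rewrite -!mulJ rmorphM/=; ring.
rewrite mulN1r oppr_ge0 ReD !ReM ReJ /= !mulr0 !subr0.
by rewrite -oppr_ge0 opprD addr_ge0// -mulNr mulr_ge0 ?oppr_ge0 ?sqr_ge0.
Qed.

End System.

(** * Dependence of the solutions on the frequency *)

Section FrequencyDependence.
Context {R : realType}.
Local Notation mu := (@lebesgue_measure R).

(** What Duhamel's formula requires of i w C' and i w rho'. Differentiability is asked for each [t]
    separately, but the Lipschitz bound is uniform in [t]: it supplies the dominating constant. *)
Record coefficient_family (a : R) (alpha : R[i] -> R -> R[i]) (B : R) : Prop :=
  CoefficientFamily {
  coef_le : forall w t, 0 <= Im w -> 0 <= t -> t <= a -> nc (alpha w t) <= B * nc w ;
  coef_ccvg : forall u w t, (forall n, 0 <= Im (u n)) -> 0 <= Im w -> ccvg u w ->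
    0 <= t -> t <= a -> ccvg (fun n => alpha (u n) t) (alpha w t) ;
  coef_lip : forall w, 0 < Im w -> exists L : R, 0 <= L /\
    forall h t, 2 * nc h <= Im w -> 0 <= t -> t <= a ->
      nc (alpha (w + h) t - alpha w t) <= L * nc h ;
  coef_cderiv : forall w t, 0 < Im w -> 0 <= t -> t <= a ->
    exists d, cderiv (alpha^~ t) w d }.

Lemma ccvg_bounded (u : nat -> R[i]) (l : R[i]) : ccvg u l ->
  exists2 W, 0 <= W & forall n, nc (u n) <= W.
Proof.
move=> /ccvg_nc ul; have : cvgn (fun n => nc (u n)) by apply/cvg_ex; exists (nc l).
move=> /cvg_seq_bounded[M [_ /(_ (`|M| + 1))]].
rewrite ltr_pwDr ?ler_norm// => /(_ isT) H; exists (`|M| + 1); first by rewrite addr_ge0.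
by move=> n; exact: le_trans (ler_norm _) (H n I).
Qed.

Section Family.
Variables (a : R) (alpha beta : R[i] -> R -> R[i]) (B : R).
Hypotheses (a0 : 0 <= a) (B0 : 0 <= B).
Hypothesis alphaF : coefficient_family a alpha B.
Hypothesis betaF : coefficient_family a beta B.

Definition solution_family (v p : R[i] -> R -> R[i]) (v0 p0 : R[i]) :=
  forall w, 0 <= Im w -> [/\ solution a (alpha w) (beta w) (v w) (p w),
    v w 0 = v0 & p w 0 = p0].

Lemma solution_family_le v p v0 p0 W : solution_family v p v0 p0 -> 0 <= W ->
  exists2 K, 0 <= K & forall w t, 0 <= Im w -> nc w <= W -> 0 <= t -> t <= a ->
    nc (v w t) <= K /\ nc (p w t) <= K.
Proof.
(* The summand 1 ensures [0 < L], as [gronwall] asks. *)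
move=> sol W0; pose L := B * W + 1.
have L0 : 0 < L by rewrite ltr_wpDl// mulr_ge0.
exists (2 * (nc v0 + nc p0) * expR (8 * L * a)).
  by rewrite !mulr_ge0 ?addr_ge0 ?nc_ge0 ?expR_ge0.
move=> w t w0 wW t0 ta; have [s s0 s1] := sol w w0.
have : nc (v w t) + nc (p w t) <= 2 * (nc (v w 0) + nc (p w 0)) * expR (8 * L * a).
  apply: (gronwall L0 a0 _ s) => // x x0 xa; split.
    apply: le_trans (coef_le alphaF w0 x0 xa) _.
    by rewrite ler_wpDr// ler_wpM2l.
  apply: le_trans (coef_le betaF w0 x0 xa) _.
  by rewrite ler_wpDr// ler_wpM2l.
rewrite s0 s1 => vp; have := nc_ge0 (v w t); have := nc_ge0 (p w t).
by split; lra.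
Qed.

Variables (V1 P1 V2 P2 : R[i] -> R -> R[i]).
Hypothesis sol1 : solution_family V1 P1 1 0.
Hypothesis sol2 : solution_family V2 P2 0 1.

Lemma det_fundamental w x : 0 <= Im w -> 0 <= x -> x <= a ->
  V1 w x * P2 w x - P1 w x * V2 w x = 1.
Proof.
move=> w0 x0 xa; have [s1 v1 p1] := sol1 w0; have [s2 v2 p2] := sol2 w0.
rewrite (wronskian s1 s2 x0 xa) v1 p1 v2 p2 (@eq_cintegral _ _ _ (fun=> 0)).
  by rewrite cintegral_cst//; ring.
by move=> t _; ring.
Qed.

(** The change, from frequency [w] to [w'], of the Wronskian of [(v, p)] with the solution
    [(Vk, Pk)] kept at frequency [w]. *)
Definition duhamel_integral (v p Vk Pk : R[i] -> R -> R[i]) w' w x :=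
  cintegral `[0, x] (fun t => (alpha w' t - alpha w t) * (p w' t * Pk w t) -
                              (beta w' t - beta w t) * (v w' t * Vk w t)).

Section OneSolution.
Variables (v p : R[i] -> R -> R[i]) (v0 p0 : R[i]).
Hypothesis sol : solution_family v p v0 p0.

Let wronskian_duhamel Vk Pk c d w' w x : solution_family Vk Pk c d ->
  0 <= Im w' -> 0 <= Im w -> 0 <= x -> x <= a ->
  v w' x * Pk w x - p w' x * Vk w x = (v w x * Pk w x - p w x * Vk w x) +
    duhamel_integral v p Vk Pk w' w x.
Proof.
move=> solk w'0 w0 x0 xa; have [s' sv' sp'] := sol w'0; have [s sv sp] := sol w0.
have [sk vk pk] := solk w w0.
rewrite (wronskian s' sk x0 xa) (wronskian s sk x0 xa) sv' sp' sv sp.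
rewrite [X in _ = _ + X + _](@eq_cintegral _ _ _ (fun=> 0)).
  by rewrite cintegral_cst// mul0r addr0.
by move=> t _; ring.
Qed.

(** The Wronskians with the two fundamental solutions form a linear system for [v w' x] and [p w' x]
    whose determinant is 1; Cramer's rule solves it. *)
Lemma duhamel_v w' w x : 0 <= Im w' -> 0 <= Im w -> 0 <= x -> x <= a ->
  v w' x = v w x + (duhamel_integral v p V2 P2 w' w x * V1 w x -
                    duhamel_integral v p V1 P1 w' w x * V2 w x).
Proof.
move=> w'0 w0 x0 xa; have D := det_fundamental w0 x0 xa.
have E1 := wronskian_duhamel sol1 w'0 w0 x0 xa.
have E2 := wronskian_duhamel sol2 w'0 w0 x0 xa.
have -> : duhamel_integral v p V2 P2 w' w x =
  v w' x * P2 w x - p w' x * V2 w x - (v w x * P2 w x - p w x * V2 w x) by rewrite E2; ring.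
have -> : duhamel_integral v p V1 P1 w' w x =
  v w' x * P1 w x - p w' x * V1 w x - (v w x * P1 w x - p w x * V1 w x) by rewrite E1; ring.
rewrite -[LHS]mulr1 -[X in _ = X + _]mulr1 -D; ring.
Qed.

Lemma duhamel_p w' w x : 0 <= Im w' -> 0 <= Im w -> 0 <= x -> x <= a ->
  p w' x = p w x + (duhamel_integral v p V2 P2 w' w x * P1 w x -
                    duhamel_integral v p V1 P1 w' w x * P2 w x).
Proof.
move=> w'0 w0 x0 xa; have D := det_fundamental w0 x0 xa.
have E1 := wronskian_duhamel sol1 w'0 w0 x0 xa.
have E2 := wronskian_duhamel sol2 w'0 w0 x0 xa.
have -> : duhamel_integral v p V2 P2 w' w x =
  v w' x * P2 w x - p w' x * V2 w x - (v w x * P2 w x - p w x * V2 w x) by rewrite E2; ring.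
have -> : duhamel_integral v p V1 P1 w' w x =
  v w' x * P1 w x - p w' x * V1 w x - (v w x * P1 w x - p w x * V1 w x) by rewrite E1; ring.
rewrite -[LHS]mulr1 -[X in _ = X + _]mulr1 -D; ring.
Qed.

Let sub_itv x t : x <= a -> `[0, x]%classic t -> 0 <= t /\ t <= a.
Proof.
by move=> xa; rewrite /= in_itv/= => /andP[t0 tx]; split => //; exact: le_trans xa.
Qed.

Let sol_measurable v' p' c d x w : solution_family v' p' c d -> 0 <= Im w -> x <= a ->
  [/\ cmeasurable `[0, x] (v' w), cmeasurable `[0, x] (p' w),
      cmeasurable `[0, x] (alpha w) & cmeasurable `[0, x] (beta w)].
Proof.
move=> s w0 xa; have [[[ma _] [mb _] [mv _] [mp _] _ _] _ _] := s w w0.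
have sub : `[0, x]%classic `<=` `[0, a]%classic by apply: subset_itv; rewrite bnd_simp.
by split; exact: cmeasurableS sub _.
Qed.

(** The solutions at [u n] enter only through a common bound, so their continuity in the frequency
    can be deduced from this limit without circularity. *)
Lemma duhamel_ccvg0 Vk Pk c d (u : nat -> R[i]) w x : solution_family Vk Pk c d ->
  (forall n, 0 <= Im (u n)) -> 0 <= Im w -> ccvg u w -> 0 <= x -> x <= a ->
  ccvg (fun n => duhamel_integral v p Vk Pk (u n) w x) 0.
Proof.
move=> solk u0 w0 uw x0 xa; have [W W0 uW] := ccvg_bounded uw.
have [K K0 vK] := solution_family_le sol W0.
have [Kk Kk0 vKk] := solution_family_le solk (nc_ge0 w).
have [mVk mPk ma mb] := sol_measurable solk w0 xa.
have -> : 0 = cintegral `[0, x] (fun=> 0 : R[i]) by rewrite cintegral_cst// mul0r.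
pose Q := (B * W + B * nc w) * (K * Kk).
have coefQ (f : R[i] -> R -> R[i]) n t : coefficient_family a f B -> 0 <= t -> t <= a ->
    nc (f (u n) t - f w t) <= B * W + B * nc w.
  move=> fF t0 ta; apply: le_trans (ncB _ _) _; apply: lerD.
    by apply: le_trans (coef_le fF (u0 n) t0 ta) _; rewrite ler_wpM2l.
  exact: (coef_le fF).
have prodQ (f : R[i] -> R -> R[i]) n t y z : coefficient_family a f B -> 0 <= t -> t <= a ->
    nc y <= K -> nc z <= Kk -> nc ((f (u n) t - f w t) * (y * z)) <= Q.
  move=> fF t0 ta yK zK; rewrite !Normc.normcM; apply: ler_pM; rewrite ?mulr_ge0 ?nc_ge0//.
    exact: coefQ.
  by apply: ler_pM; rewrite ?nc_ge0.
apply: (@cintegral_ccvg _ _ _ _ (fun=> Q + Q)) => //.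
- move=> n; have [mv mp man mbn] := sol_measurable sol (u0 n) xa.
  by apply: cmeasurableB; apply: cmeasurableM; (apply: cmeasurableB || apply: cmeasurableM).
- move=> t /(sub_itv xa)[t0 ta].
  have small (f : R[i] -> R -> R[i]) (y : nat -> R[i]) z : coefficient_family a f B ->
      (forall n, nc (y n) <= K) -> nc z <= Kk ->
      ccvg (fun n => (f (u n) t - f w t) * (y n * z)) 0.
    move=> fF yK zK.
    apply: (@squeeze_ccvg _ _ _ (fun n => nc (f (u n) t - f w t) * (K * Kk))).
      move=> n; rewrite subr0 !Normc.normcM ler_wpM2l ?nc_ge0//.
      by apply: ler_pM; rewrite ?nc_ge0.
    rewrite -(mul0r (K * Kk)); apply: cvgM; last exact: cvg_cst.
    exact: ccvg_nc0 (coef_ccvg fF u0 w0 uw t0 ta).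
  rewrite -(subrr 0); apply: ccvgB; apply: small => //.
  + by move=> n; have [] := vK _ _ (u0 n) (uW n) t0 ta.
  + by have [] := vKk _ _ w0 (lexx _) t0 ta.
  + by move=> n; have [] := vK _ _ (u0 n) (uW n) t0 ta.
  + by have [] := vKk _ _ w0 (lexx _) t0 ta.
- exact: integrable_cst_itv.
- move=> n t /(sub_itv xa)[t0 ta]; apply: le_trans (ncB _ _) _.
  have [? ?] := vK _ _ (u0 n) (uW n) t0 ta; have [? ?] := vKk _ _ w0 (lexx _) t0 ta.
  by apply: lerD; exact: prodQ.
Qed.

Lemma solution_family_ccvg (u : nat -> R[i]) w x :
  (forall n, 0 <= Im (u n)) -> 0 <= Im w -> ccvg u w -> 0 <= x -> x <= a ->
  ccvg (fun n => v (u n) x) (v w x) /\ ccvg (fun n => p (u n) x) (p w x).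
Proof.
move=> u0 w0 uw x0 xa.
have c1 := duhamel_ccvg0 sol1 u0 w0 uw x0 xa; have c2 := duhamel_ccvg0 sol2 u0 w0 uw x0 xa.
have lim (y z : R[i]) : ccvg (fun n => duhamel_integral v p V2 P2 (u n) w x * y -
    duhamel_integral v p V1 P1 (u n) w x * z) 0.
  by have := ccvgB (ccvgM c2 (ccvg_cst y)) (ccvgM c1 (ccvg_cst z)); rewrite !mul0r subr0.
split.
  under eq_fun do rewrite (duhamel_v (u0 _) w0 x0 xa).
  by rewrite -[X in ccvg _ X]addr0; apply: ccvgD (lim _ _); exact: ccvg_cst.
under eq_fun do rewrite (duhamel_p (u0 _) w0 x0 xa).
by rewrite -[X in ccvg _ X]addr0; apply: ccvgD (lim _ _); exact: ccvg_cst.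
Qed.

(** The derivative is the integral with the coefficients differentiated in [w]: the quotients
    converge pointwise by [coef_cderiv] and [solution_family_ccvg], under the bound given by
    [coef_lip]. *)
Lemma duhamel_cderiv Vk Pk c d w x : solution_family Vk Pk c d ->
  0 < Im w -> 0 <= x -> x <= a ->
  exists D, forall h : nat -> R[i], (forall n, h n != 0) ->
    (forall n, 2 * nc (h n) <= Im w) -> ccvg h 0 ->
    ccvg (fun n => duhamel_integral v p Vk Pk (w + h n) w x / h n) D.
Proof.
move=> solk w_gt0 x0 xa; have w0 := ltW w_gt0.
have coefd f : coefficient_family a f B -> exists fd : R -> R[i],
    forall t, 0 <= t -> t <= a -> cderiv (f^~ t) w (fd t).
  move=> fF; have H t : exists e, 0 <= t -> t <= a -> cderiv (f^~ t) w e.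
    have [[t0 ta]|nt] := pselect (0 <= t /\ t <= a).
      by have [e he] := coef_cderiv fF w_gt0 t0 ta; exists e.
    (* Outside [0, a] the chosen derivative is an arbitrary value. *)
    by exists 0 => t0 ta; case: nt.
  by have [fd fdP] := choice H; exists fd.
have [ad adP] := coefd _ alphaF; have [bd bdP] := coefd _ betaF.
exists (cintegral `[0, x] (fun t => ad t * (p w t * Pk w t) - bd t * (v w t * Vk w t))).
move=> h h_neq0 hw hc.
pose u n := w + h n.
have uw : ccvg u w by rewrite -[X in ccvg _ X]addr0; apply: ccvgD hc; exact: ccvg_cst.
have u0 n : 0 <= Im (u n).
  rewrite /u ImD; have := Im_le_nc (h n); have := hw n; rewrite ler_norml => ? /andP[]; lra.
have [W W0 uW] := ccvg_bounded uw.
have [K K0 vK] := solution_family_le sol W0.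
have [Kk Kk0 vKk] := solution_family_le solk (nc_ge0 w).
have [mVk mPk ma mb] := sol_measurable solk w0 xa.
have [La [La0 LaP]] := coef_lip alphaF w_gt0; have [Lb [Lb0 LbP]] := coef_lip betaF w_gt0.
have meas n : [/\ cmeasurable `[0, x] (v (u n)), cmeasurable `[0, x] (p (u n)),
    cmeasurable `[0, x] (alpha (u n)) & cmeasurable `[0, x] (beta (u n))].
  exact: sol_measurable sol (u0 n) xa.
pose g n t := (alpha (u n) t - alpha w t) / h n * (p (u n) t * Pk w t) -
  (beta (u n) t - beta w t) / h n * (v (u n) t * Vk w t).
have gm n : cmeasurable `[0, x] (g n).
  have [mv mp man mbn] := meas n.
  apply: cmeasurableB; apply: cmeasurableM; try exact: cmeasurableM.
    by apply: cmeasurableM; [exact: cmeasurableB|exact: cmeasurable_cst].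
  by apply: cmeasurableM; [exact: cmeasurableB|exact: cmeasurable_cst].
pose Q := La * (K * Kk) + Lb * (K * Kk).
have gQ n t : `[0, x]%classic t -> nc (g n t) <= Q.
  move=> /(sub_itv xa)[t0 ta]; apply: le_trans (ncB _ _) _.
  have [? ?] := vK _ _ (u0 n) (uW n) t0 ta; have [? ?] := vKk _ _ w0 (lexx _) t0 ta.
  have hn0 : 0 < nc (h n) by rewrite nc_gt0.
  apply: lerD; rewrite Normc.normcM; apply: ler_pM; rewrite ?nc_ge0//.
  - by rewrite nc_div ler_pdivrMr//; exact: LaP.
  - by rewrite Normc.normcM; apply: ler_pM; rewrite ?nc_ge0.
  - by rewrite nc_div ler_pdivrMr//; exact: LbP.
  - by rewrite Normc.normcM; apply: ler_pM; rewrite ?nc_ge0.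
have iQ : mu.-integrable `[0, x] (EFin \o (fun=> Q)) by exact: integrable_cst_itv.
rewrite (_ : (fun _ => _) = fun n => cintegral `[0, x] (g n)); last first.
  apply/funext => n; have [mv mp man mbn] := meas n.
  rewrite (@eq_cintegral _ _ (g n) (fun t => (h n)^-1 *
      ((alpha (u n) t - alpha w t) * (p (u n) t * Pk w t) -
       (beta (u n) t - beta w t) * (v (u n) t * Vk w t)))); last first.
    by move=> t _; rewrite /g; field.
  rewrite cintegralZl//; first by rewrite mulrC.
  have := cintegrableZl (h n) _ (dominated_cintegrable _ (gm n) iQ (gQ n)).
  move=> /(_ (measurable_itv _) (measurable_itv _)).
  congr cintegrable; apply/funext => t; rewrite /g; field.
  exact: h_neq0.
apply: (cintegral_ccvg _ gm _ iQ gQ) => // t /(sub_itv xa)[t0 ta].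
have [cv cp] := solution_family_ccvg u0 w0 uw t0 ta.
apply: ccvgB; apply: ccvgM; try (apply: ccvgM => //; exact: ccvg_cst).
  exact: adP.
exact: bdP.
Qed.

Lemma solution_family_cderiv w x : 0 < Im w -> 0 <= x -> x <= a ->
  exists d, cderiv (v^~ x) w d.
Proof.
move=> w0 x0 xa.
have [D1 H1] := duhamel_cderiv sol1 w0 x0 xa; have [D2 H2] := duhamel_cderiv sol2 w0 x0 xa.
exists (D2 * V1 w x - D1 * V2 w x) => h h0 hw hc.
have u0 n : 0 <= Im (w + h n).
  rewrite ImD; have := Im_le_nc (h n); have := hw n; rewrite ler_norml => ? /andP[]; lra.
rewrite (_ : (fun _ => _) = fun n =>
    duhamel_integral v p V2 P2 (w + h n) w x / h n * V1 w x -
    duhamel_integral v p V1 P1 (w + h n) w x / h n * V2 w x).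
  by apply: ccvgB; apply: ccvgM; do ?exact: ccvg_cst; [exact: H2|exact: H1].
apply/funext => n; rewrite (duhamel_v (u0 n) (ltW w0) x0 xa); field.
exact: h0.
Qed.

End OneSolution.
End Family.
End FrequencyDependence.

(** * Sequential convergence and the topology of [R[i]^o] *)

Section ComplexTopology.
Context {R : realType}.

Lemma ccvg_topology (u : nat -> R[i]) (l : R[i]) :
  ccvg u l <-> (u : nat -> R[i]^o) @ \oo --> (l : R[i]^o).
Proof.
split=> [ul|/cvgrPdist_lt ul].
  (* The norm takes values in [R[i]], so [e] is a complex number; being positive, it is real. *)
  apply/cvgrPdist_lt => e e0; have eE : e = (Re e)%:C by rewrite RRe_real// gtr0_real.
  have Re0 : 0 < Re e by rewrite -ltcR -eE.
  apply: filterS (ccvg_eps ul Re0) => n; rewrite ncBC => un.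
  by rewrite normcE eE ltcR.
apply: eps_ccvg => e e0; have e0' : 0 < e%:C by rewrite ltcR.
apply: filterS (ul _ e0') => n; rewrite normcE ltcR ncBC; exact: ltW.
Qed.

Lemma continuous_Re : continuous (fun z : R[i]^o => Re z).
Proof.
move=> z P [e /= e0 eP]; exists e%:C; first by rewrite /= ltcR.
move=> w /=; rewrite normcE ltcR => zw; apply: eP => /=.
by rewrite -ReN -ReD; apply: le_lt_trans (Re_le_nc _) zw.
Qed.

Lemma continuous_Im : continuous (fun z : R[i]^o => Im z).
Proof.
move=> z P [e /= e0 eP]; exists e%:C; first by rewrite /= ltcR.
move=> w /=; rewrite normcE ltcR => zw; apply: eP => /=.
by rewrite -ImN -ImD; apply: le_lt_trans (Im_le_nc _) zw.
Qed.

Lemma continuous_bounded_measurable (a : R) (f : R -> R[i]) : 0 <= a ->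
  {within `[0, a], continuous (f : R -> R[i]^o)} -> bounded_measurable a f.
Proof.
move=> a0 fc.
have rc : {within `[0, a], continuous (fun x => Re (f x))}.
  by move=> x; apply: (@continuous_comp _ _ _ _ (fun z : R[i]^o => Re z)); [exact: fc|exact: continuous_Re].
have ic : {within `[0, a], continuous (fun x => Im (f x))}.
  by move=> x; apply: (@continuous_comp _ _ _ _ (fun z : R[i]^o => Im z)); [exact: fc|exact: continuous_Im].
have bnd (h : R -> R) : {within `[0, a], continuous h} ->
    exists K : R, forall x, 0 <= x -> x <= a -> `|h x| <= K.
  move=> hc; have [c1 _ h1] := EVT_max a0 hc; have [c2 _ h2] := EVT_min a0 hc.
  exists (`|h c1| + `|h c2|) => x x0 xa.
  have xI : x \in `[0, a] by rewrite in_itv/= x0.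
  rewrite ler_norml; have := h1 x xI; have := h2 x xI.
  have := ler_norm (h c1); have := ler_norm (- h c2); rewrite normrN.
  have := normr_ge0 (h c1); have := normr_ge0 (h c2) => ? ? ? ? ? ?.
  by apply/andP; split; lra.
split.
  by split; apply: subspace_continuous_measurable_fun.
have [K1 K1P] := bnd _ rc; have [K2 K2P] := bnd _ ic.
exists (K1 + K2) => x x0 xa; apply: le_trans (nc_le_ReIm _) _.
by apply: lerD; [exact: K1P|exact: K2P].
Qed.

End ComplexTopology.

(** * Regularity of the slab's coefficients in the frequency *)

Section Slab.
Context {R : realType}.
Variables (a : R) (f : R -> R[i] -> R[i]).
Hypothesis fS : slab_property a f.
Local Notation ii := (0 +i* 1 : R[i]).

Let in_slab x : 0 <= x -> x <= a -> x \in `[0, a].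
Proof. by move=> x0 xa; rewrite in_itv/= x0. Qed.

Lemma slab_le : exists2 B, 0 <= B &
  forall x w, 0 <= x -> x <= a -> 0 <= Im w -> nc (f x w) <= B.
Proof.
have [B BP] := slab_bounded fS; exists `|B| => // x w x0 xa w0.
apply: le_trans (ler_norm _); have := BP x w (in_slab x0 xa) w0.
by rewrite normcE lecR.
Qed.

Lemma slab_ccvg x (u : nat -> R[i]) w : 0 <= x -> x <= a ->
  (forall n, 0 <= Im (u n)) -> 0 <= Im w -> ccvg u w ->
  ccvg (fun n => f x (u n)) (f x w).
Proof.
move=> x0 xa u0 w0 /ccvg_topology uw; apply/ccvg_topology => P fP.
have /subspace_continuousP/(_ w w0 P fP) := slab_continuous fS (in_slab x0 xa).
move=> /uw; apply: (@filterS _ _ (@eventually_filter)) => n; apply; exact: u0.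
Qed.

Lemma slab_cderiv x w : 0 <= x -> x <= a -> 0 < Im w -> exists d, cderiv (f x) w d.
Proof.
move=> x0 xa w0; have /cvg_ex[/= d dP] := slab_analytic fS (in_slab x0 xa) w0.
exists d => h h0 hw hc.
have hc' : (h : nat -> R[i]^o) @ \oo --> (0 : R[i]^o)^'.
  move=> P [e /= e0 eP]; move/ccvg_topology/cvgrPdist_lt : hc => /(_ e e0).
  by apply: filterS => n hn; apply: eP.
apply/ccvg_topology; rewrite (_ : (fun n => _) =
  (fun k : R[i]^o => k^-1 *: ((f x : R[i]^o -> R[i]^o) (k *: 1 + w) - f x w)) \o h).
  exact: cvg_comp hc' dP.
by apply/funext => n /=; rewrite /GRing.scale/= mulr1 mulrC (addrC (h n)).
Qed.

Lemma slab_bounded_holomorphic B x : 0 <= x -> x <= a ->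
  (forall x w, 0 <= x -> x <= a -> 0 <= Im w -> nc (f x w) <= B) ->
  bounded_holomorphic (f x) B.
Proof.
move=> x0 xa fB; split.
- by move=> w; exact: fB.
- by move=> t u u0 ut; apply: slab_ccvg.
- by move=> w; exact: slab_cderiv.
Qed.

Lemma slab_bounded_measurable w : 0 <= Im w -> bounded_measurable a (f^~ w).
Proof.
move=> w0; have [B B0 fB] := slab_le.
by split; [exact: (slab_measurable fS w0)|exists B => x x0 xa; exact: fB].
Qed.

(** Stated for every larger [B'] so that the two coefficients can share one bound. *)
Lemma slab_coefficient_family : exists2 B, 0 <= B &
  forall B', B <= B' -> coefficient_family a (fun w t => ii * w * f t w) B'.
Proof.
have [B B0 fB] := slab_le; exists B => // B' BB'; split.
- move=> w t w0 t0 ta; rewrite !Normc.normcM nc_i mul1r mulrC.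
  by rewrite ler_wpM2r ?nc_ge0// (le_trans (fB _ _ t0 ta w0)).
- move=> u w t u0 w0 uw t0 ta; apply: ccvgM; last exact: slab_ccvg.
  by apply: ccvgM => //; exact: ccvg_cst.
(* A Lipschitz constant for the product of w and f; [bounded_holo_lip] applies to [f t] with the
   same [B] for every [t]. *)
- move=> w w0; exists (nc w * (4 * B / Im w) + B); split.
    by rewrite addr_ge0 ?mulr_ge0 ?nc_ge0 ?invr_ge0// ltW.
  move=> h t hw t0 ta.
  have -> : ii * (w + h) * f t (w + h) - ii * w * f t w =
      ii * (w * (f t (w + h) - f t w) + h * f t (w + h)) by ring.
  rewrite Normc.normcM nc_i mul1r mulrDl; apply: le_trans (le_normcD _ _) _.
  rewrite !Normc.normcM; apply: lerD.
    rewrite -(mulrA (nc w)) ler_wpM2l ?nc_ge0//.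
    exact: (bounded_holo_lip (slab_bounded_holomorphic t0 ta fB)).
  rewrite mulrC ler_wpM2r ?nc_ge0// fB// ImD.
  by have := Im_le_nc h; rewrite ler_norml => /andP[]; lra.
- move=> w t w0 t0 ta; have [d hd] := slab_cderiv t0 ta w0.
  eexists; apply: cderivM hd => //; apply: cderivM; [exact: w0|exact: cderiv_cst|exact: cderiv_id].
Qed.

End Slab.

(** * The columns of the propagator as solutions *)

Section Propagator.
Context {R : realType}.

Lemma Qmatrix_mul (rho' C' : R -> R[i] -> R[i]) s w (N : 'M[R[i]]_2) (j : 'I_2) :
  (Qmatrix rho' C' s w *m N) 0 j = C' s w * N 1 j /\
  (Qmatrix rho' C' s w *m N) 1 j = rho' s w * N 0 j.
Proof.
have l1 : lift ord0 ord0 = 1 :> 'I_2 by apply/val_inj.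
by rewrite !mxE !big_ord_recl !big_ord0 !l1 !mxE/= !mul0r add0r !addr0.
Qed.

Variables (a : R) (rho' C' : R -> R[i] -> R[i]) (M : R -> R[i] -> 'M[R[i]]_2).
Hypotheses (a0 : 0 <= a) (rhoS : slab_property a rho') (CS : slab_property a C').
Hypothesis M_propagator : forall w : R[i], 0 <= Im w ->
  is_propagator a rho' C' w (fun x => M x w).
Local Notation ii := (0 +i* 1 : R[i]).

Lemma propagator_solution_family (j : 'I_2) :
  solution_family a (fun w t => ii * w * C' t w) (fun w t => ii * w * rho' t w)
    (fun w x => M x w 0 j) (fun w x => M x w 1 j) ((0 == j)%:R) ((1 == j)%:R).
Proof.
move=> w w0; have [Mc ME] := M_propagator w0.
have M0 : M 0 w = 1%:M.
  rewrite ME ?in_itv/= ?lexx ?a0//; apply/matrixP => i k.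
  by rewrite !mxE cintegral_point mulr0 addr0.
have cb (f : R -> R[i] -> R[i]) : slab_property a f ->
    bounded_measurable a (fun t => ii * w * f t w).
  move=> fS; apply: bounded_measurableM; first exact: bounded_measurable_cst.
  exact: (slab_bounded_measurable fS w0).
have Mb i k : bounded_measurable a (fun x => M x w i k).
  exact: continuous_bounded_measurable.
split; rewrite ?M0 ?mxE//; split => //; try exact: cb.
- move=> x x0 xa; rewrite M0 {1}ME ?in_itv/= ?x0// !mxE; congr (_ + _).
  rewrite -cintegralZl//; last first.
    apply: (bounded_measurable_integrable (a := a)) => //.
    rewrite (_ : (fun _ => _) = fun s => C' s w * M s w 1 j).
      by apply: bounded_measurableM => //; exact: slab_bounded_measurable.
    by apply/funext => s; rewrite (Qmatrix_mul _ _ _ _ _ _).1.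
  by apply: eq_cintegral => s _; rewrite (Qmatrix_mul _ _ _ _ _ _).1 mulrA.
- move=> x x0 xa; rewrite M0 {1}ME ?in_itv/= ?x0// !mxE; congr (_ + _).
  rewrite -cintegralZl//; last first.
    apply: (bounded_measurable_integrable (a := a)) => //.
    rewrite (_ : (fun _ => _) = fun s => rho' s w * M s w 0 j).
      by apply: bounded_measurableM => //; exact: slab_bounded_measurable.
    by apply/funext => s; rewrite (Qmatrix_mul _ _ _ _ _ _).2.
  by apply: eq_cintegral => s _; rewrite (Qmatrix_mul _ _ _ _ _ _).2 mulrA.
Qed.

End Propagator.

(** * The reflection coefficient *)

Section Reflection.
Context {R : realType}.
Local Notation mu := (@lebesgue_measure R).
Local Notation ii := (0 +i* 1 : R[i]).
Variables (rho C a : R) (rho' C' : R -> R[i] -> R[i]) (M : R -> R[i] -> 'M[R[i]]_2).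
Hypotheses (rho_gt0 : 0 < rho) (C_gt0 : 0 < C) (a_gt0 : 0 < a).
Hypotheses (rhoS : slab_property a rho') (CS : slab_property a C').
Hypothesis M_propagator : forall w : R[i], 0 <= Im w ->
  is_propagator a rho' C' w (fun x => M x w).

Let z := impedance rho C.
Let a_ge0 : 0 <= a := ltW a_gt0.
Let z_gt0 : 0 < z. Proof. by rewrite sqrtr_gt0 divr_gt0. Qed.
Let alpha (w : R[i]) t := ii * w * C' t w.
Let beta (w : R[i]) t := ii * w * rho' t w.
Let V1 (w : R[i]) x := M x w 0 0.
Let P1 (w : R[i]) x := M x w 1 0.
Let V2 (w : R[i]) x := M x w 0 1.
Let P2 (w : R[i]) x := M x w 1 1.

Let sol1 : solution_family a alpha beta V1 P1 1 0.
Proof. exact: (propagator_solution_family a_ge0 rhoS CS M_propagator 0). Qed.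

Let sol2 : solution_family a alpha beta V2 P2 0 1.
Proof. exact: (propagator_solution_family a_ge0 rhoS CS M_propagator 1). Qed.

Let det_M w x : 0 <= Im w -> 0 <= x -> x <= a -> V1 w x * P2 w x - P1 w x * V2 w x = 1.
Proof. exact: (det_fundamental sol1 sol2). Qed.

Definition reflection_denominator (w : R[i]) := M a w 0 0 - z%:C * M a w 0 1.

(* [1 - R], extended to complex frequencies *)
Definition reflection_defect (w : R[i]) :=
  - (2 * z)%:C * M a w 0 1 / reflection_denominator w.

Local Notation den := reflection_denominator.
Local Notation g := reflection_defect.

(* The flux of the solution with [v(a) = 0] enters the slab at x = 0. *)
Let flux_M w : 0 <= Im w -> Re (V2 w a * conjc (V1 w a)) <= 0.
Proof.
move=> w0; have [s1 v1 p1] := sol1 w0; have [s2 v2 p2] := sol2 w0.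
(* This combination of the columns has velocity 0 at [a], and initial velocity [- V2 w a] and
   pressure [V1 w a]. *)
have s := solution_lin (- V2 w a) (V1 w a) s1 s2.
have : Re ((- V2 w a * V1 w a + V1 w a * V2 w a) *
    conjc (- V2 w a * P1 w a + V1 w a * P2 w a)) <=
    Re ((- V2 w a * V1 w 0 + V1 w a * V2 w 0) *
    conjc (- V2 w a * P1 w 0 + V1 w a * P2 w 0)).
  apply: (flux_nonincreasing a_ge0 s) => x x0 xa.
  have xI : x \in `[0, a] by rewrite in_itv/= x0.
  have := slab_passive CS xI w0; have := slab_passive rhoS xI w0.
  by rewrite /alpha /beta -!mulrA !ReM !mul0r !mul1r !sub0r !oppr_le0.
rewrite v1 p1 v2 p2 (_ : - V2 w a * V1 w a + V1 w a * V2 w a = 0); last by ring.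
rewrite mul0r (_ : _ * conjc _ = - (V2 w a * conjc (V1 w a))).
  by rewrite ReN /= oppr_ge0.
by rewrite !mulr0 !mulr1 addr0 add0r mulNr.
Qed.

(** For [e = z] and [e = - z] these are the numerator and the denominator of R. They differ in the
    sign of the cross term alone, which [flux_M] determines. *)
Let nc_den w (e : R) : nc (V1 w a + e%:C * V2 w a) ^+ 2 =
  nc (V1 w a) ^+ 2 + e ^+ 2 * nc (V2 w a) ^+ 2 + 2 * e * Re (V2 w a * conjc (V1 w a)).
Proof.
by rewrite !nc_sqr; case: (V1 w a) => x y; case: (V2 w a) => s t /=; ring.
Qed.

Let denE w : den w = V1 w a + (- z)%:C * V2 w a.
Proof. by rewrite /den rmorphN/= mulNr. Qed.

(** By [flux_M] the squared norm is a sum of three nonnegative terms; if it vanished, so would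
    [V1 w a] and [V2 w a], against the determinant 1. *)
Let den_neq0 w : 0 <= Im w -> den w != 0.
Proof.
move=> w0; apply/negP => /eqP D0; have F := flux_M w0.
have := nc_den w (- z); rewrite -denE D0 nc0 expr0n /= sqrrN => /esym/eqP.
have h1 : 0 <= nc (V1 w a) ^+ 2 by exact: sqr_ge0.
have h2 : 0 <= z ^+ 2 * nc (V2 w a) ^+ 2 by rewrite mulr_ge0 ?sqr_ge0.
have h3 : 0 <= 2 * - z * Re (V2 w a * conjc (V1 w a)).
  by rewrite mulrN mulNr -mulrN mulr_ge0 ?oppr_ge0// mulr_ge0// ltW.
rewrite paddr_eq0 ?addr_ge0// paddr_eq0// => /andP[/andP[E1 E2] _].
have {}E1 : V1 w a = 0 by apply/eqP; rewrite -nc_eq0 -sqrf_eq0.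
have {}E2 : V2 w a = 0.
  move: E2; rewrite mulf_eq0 sqrf_eq0 (gt_eqF z_gt0)/= sqrf_eq0 nc_eq0.
  by move/eqP.
have := det_M w0 a_ge0 (lexx a); rewrite E1 E2 mul0r mulr0 subr0 => /eqP.
by rewrite eq_sym oner_eq0.
Qed.

Let one_sub_g w : 0 <= Im w -> 1 - g w = (V1 w a + z%:C * V2 w a) / den w.
Proof.
move=> w0; have := den_neq0 w0; rewrite /g /den /V1 /V2 => D0.
by rewrite rmorphM/= rmorph_nat; field.
Qed.

Let nc_one_sub_g w : 0 <= Im w -> nc (1 - g w) <= 1.
Proof.
move=> w0; have D0 := den_neq0 w0.
rewrite one_sub_g// nc_div ler_pdivrMr ?nc_gt0// mul1r.
rewrite -(@ler_pXn2r _ 2) ?nnegrE ?nc_ge0// denE !nc_den sqrrN.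
rewrite lerD2l mulrN mulNr -subr_ge0 -opprD oppr_ge0 -mulr2n pmulrn_lle0//.
by rewrite mulr_ge0_le0 ?flux_M// mulr_ge0// ltW.
Qed.

Lemma reflection_defect_Re_ge0 w : 0 <= Im w -> 0 <= Re (g w).
Proof.
move=> w0; have := Re_le_nc (1 - g w); have := nc_one_sub_g w0.
have -> : Re (1 - g w) = 1 - Re (g w) by rewrite ReD ReN.
by rewrite ler_norml => h1 /andP[_ h2]; lra.
Qed.

Lemma reflection_defect_holomorphic : bounded_holomorphic g 2.
Proof.
have [Ba Ba0 Fa] := slab_coefficient_family CS.
have [Bb Bb0 Fb] := slab_coefficient_family rhoS.
have {}Fa : coefficient_family a alpha (Ba + Bb) by apply: Fa; rewrite lerDl.
have {}Fb : coefficient_family a beta (Ba + Bb) by apply: Fb; rewrite lerDr.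
have B0 : 0 <= Ba + Bb by rewrite addr_ge0.
split.
- move=> w w0; rewrite -[g w](subKr 1); apply: le_trans (ncB _ _) _.
  by rewrite nc1; have := nc_one_sub_g w0; lra.
- move=> t u u0 ut; have t0 : 0 <= Im (t%:C) by [].
  have [c1 _] := solution_family_ccvg a_ge0 B0 Fa Fb sol1 sol2 sol1 u0 t0 ut a_ge0 (lexx a).
  have [c2 _] := solution_family_ccvg a_ge0 B0 Fa Fb sol1 sol2 sol2 u0 t0 ut a_ge0 (lexx a).
  apply: ccvgM; first by apply: ccvgM => //; exact: ccvg_cst.
  apply: ccvgV; first exact: den_neq0.
  by apply: ccvgB => //; apply: ccvgM => //; exact: ccvg_cst.
- move=> w w0.
  have [d1 h1] := solution_family_cderiv a_ge0 B0 Fa Fb sol1 sol2 sol1 w0 a_ge0 (lexx a).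
  have [d2 h2] := solution_family_cderiv a_ge0 B0 Fa Fb sol1 sol2 sol2 w0 a_ge0 (lexx a).
  eexists; apply: (cderivM w0); first by apply: (cderivM w0) h2; exact: cderiv_cst.
  apply: (cderivV w0); first exact: den_neq0 (ltW w0).
  by apply: cderivB h1 _; apply: (cderivM w0) h2; exact: cderiv_cst.
Qed.

(* As [M12 = i w int C' M22] and [M(x, 0) = 1], [(1 - R) / (- i w)] tends to
   [2 z int C'(x, 0)] at low frequency. *)
Lemma reflection_defect_low_frequency :
  (fun n => n.+1%:R * Re (g (0 +i* n.+1%:R^-1))) @ \oo -->
  2 * z * \int[mu]_(x in `[0, a]) Re (C' x 0).
Proof.
have [Ba Ba0 Fa] := slab_coefficient_family CS.
have [Bb Bb0 Fb] := slab_coefficient_family rhoS.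
have {}Fa : coefficient_family a alpha (Ba + Bb) by apply: Fa; rewrite lerDl.
have {}Fb : coefficient_family a beta (Ba + Bb) by apply: Fb; rewrite lerDr.
have B0 : 0 <= Ba + Bb by rewrite addr_ge0.
pose u n : R[i] := 0 +i* n.+1%:R^-1.
have u0 n : 0 <= Im (u n) by rewrite /= invr_ge0.
have w0 : 0 <= Im (0 : R[i]) by [].
have uc : ccvg u 0 by apply: ccvg_complex; [exact: cvg_cst|exact: cvg_harmonic].
have lim1 x x0 xa := solution_family_ccvg a_ge0 B0 Fa Fb sol1 sol2 sol1 u0 w0 uc (x := x) x0 xa.
have lim2 x x0 xa := solution_family_ccvg a_ge0 B0 Fa Fb sol1 sol2 sol2 u0 w0 uc (x := x) x0 xa.
(* At frequency 0 both coefficients vanish, so solutions keep their initial values. *)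
have static v p v0 p0 : solution_family a alpha beta v p v0 p0 ->
    forall x, 0 <= x -> x <= a -> v 0 x = v0 /\ p 0 x = p0.
  move=> s x x0 xa; have [[_ _ _ _ sv sp] i1 i2] := s 0 w0.
  rewrite (sv x)// (sp x)// i1 i2.
  rewrite (@eq_cintegral _ _ (fun t => alpha 0 t * p 0 t) (fun=> 0)); last first.
    by move=> t _; rewrite /alpha mulr0 !mul0r.
  rewrite (@eq_cintegral _ _ (fun t => beta 0 t * v 0 t) (fun=> 0)); last first.
    by move=> t _; rewrite /beta mulr0 !mul0r.
  by rewrite cintegral_cst// mul0r !addr0.
have [B0' B0'0 CB] := slab_le CS.
have [W W0 uW] := ccvg_bounded uc.
have [K K0 pK] := solution_family_le a_ge0 B0 Fa Fb sol2 W0.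
have P2m w : 0 <= Im w -> cmeasurable `[0, a] (P2 w).
  by move=> w1; have [[_ _ _ [+ _] _ _] _ _] := sol2 w1.
have Cm w : 0 <= Im w -> cmeasurable `[0, a] (fun t => C' t w).
  by move=> w1; have [] := slab_bounded_measurable CS w1.
pose J n := cintegral `[0, a] (fun t => C' t (u n) * P2 (u n) t).
have itvP t : `[0, a]%classic t -> 0 <= t /\ t <= a by rewrite /= in_itv/= => /andP.
have JK n t : `[0, a]%classic t -> nc (C' t (u n) * P2 (u n) t) <= B0' * K.
  move=> /itvP[t0 ta]; rewrite Normc.normcM; apply: ler_pM; rewrite ?nc_ge0//.
    exact: CB.
  by have [] := pK _ _ (u0 n) (uW n) t0 ta.
have J_meas n : cmeasurable `[0, a] (fun t => C' t (u n) * P2 (u n) t).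
  by apply: cmeasurableM; [exact: Cm|exact: P2m].
have J_lim : ccvg J (cintegral `[0, a] (fun t => C' t 0)).
  apply: (cintegral_ccvg (k := fun=> B0' * K)) => //; last exact: integrable_cst_itv.
  move=> t /itvP[t0 ta]; rewrite -[X in ccvg _ X]mulr1; apply: ccvgM.
    exact: (slab_ccvg CS).
  have [_] := lim2 t t0 ta; by have [_ ->] := static _ _ _ _ sol2 t t0 ta.
(* At w = i / (n + 1) the factor i w of [alpha] is the real number - 1 / (n + 1). *)
have V2E n : V2 (u n) a = - (n.+1%:R^-1)%:C * J n.
  have [[_ _ _ _ sv _] i1 _] := sol2 (u0 n).
  rewrite (sv a)// i1 add0r /J -cintegralZl//.
    apply: eq_cintegral => t _; rewrite /alpha mulrA; congr (_ * _ * _).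
    by apply: complex_ext => /=; ring.
  by apply: (bounded_cintegrable (K := B0' * K)) => // t /JK.
have g_lim : ccvg (fun n => (2 * z)%:C * J n / den (u n))
    ((2 * z)%:C * cintegral `[0, a] (fun t => C' t 0) / 1).
  apply: ccvgM; first by apply: ccvgM => //; exact: ccvg_cst.
  apply: ccvgV; first exact: oner_neq0.
  have [c1 _] := lim1 a a_ge0 (lexx a); have [c2 _] := lim2 a a_ge0 (lexx a).
  have := ccvgB c1 (ccvgM (ccvg_cst z%:C) c2).
  have [-> _] := static _ _ _ _ sol1 a a_ge0 (lexx a).
  by have [-> _] := static _ _ _ _ sol2 a a_ge0 (lexx a); rewrite mulr0 subr0.
have [gr _] := g_lim; rewrite divr1 ReM /= mul0r subr0 in gr.
rewrite (_ : (fun n => _) = fun n => Re ((2 * z)%:C * J n / den (u n))) //.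
apply/funext => n.
have n0 : (n.+1%:R : R) != 0 by rewrite pnatr_eq0.
have -> : g (0 +i* n.+1%:R^-1) = (n.+1%:R^-1)%:C * ((2 * z)%:C * J n / den (u n)).
  by rewrite /g -/(u n) -/(V2 (u n) a) V2E; ring.
by rewrite [in LHS]ReM /= mul0r subr0 mulrA mulfV// mul1r.
Qed.

(* [M(x, - w^* )] and [M(x, w)^*] solve the same system. *)
Lemma reflection_defect_even (t : R) : Re (g (- t)%:C) = Re (g t%:C).
Proof.
have t0 : 0 <= Im t%:C by []; have mt0 : 0 <= Im (- t)%:C by [].
have mtE : (- t)%:C = - conjc t%:C by apply: complex_ext; rewrite /= ?opprK ?oppr0.
have coefJ (f : R -> R[i] -> R[i]) x : slab_property a f -> 0 <= x -> x <= a ->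
    conjc (ii * t%:C * f x t%:C) = ii * (- t)%:C * f x (- t)%:C.
  move=> fS x0 xa; have xI : x \in `[0, a] by rewrite in_itv/= x0.
  rewrite mtE (slab_real_response fS xI t0) !rmorphM/=; congr (_ * _).
  by apply: complex_ext => /=; ring.
have uniq v p v0 p0 : solution_family a alpha beta v p v0 p0 ->
    conjc v0 = v0 -> conjc p0 = p0 -> conjc (v t%:C a) = v (- t)%:C a.
  move=> s v0J p0J; have [s' v'0 p'0] := s _ mt0; have [st vt0 pt0] := s _ t0.
  have [s1 v1 p1] := sol1 mt0; have [s2 v2 p2] := sol2 mt0.
  have sJ := solutionJ st.
  (* By [coefJ] the conjugated system has the coefficients of the system at [- t]. The two solutions
     thus have the same Wronskian with each fundamental column, and the determinant 1 makes them
     agree at [a]. *)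
  have W vk pk : solution a (alpha (- t)%:C) (beta (- t)%:C) vk pk ->
      conjc (v t%:C a) * pk a - conjc (p t%:C a) * vk a =
      v (- t)%:C a * pk a - p (- t)%:C a * vk a.
    move=> sks; rewrite (wronskian sJ sks a_ge0 (lexx a)) (wronskian s' sks a_ge0 (lexx a)).
    rewrite vt0 pt0 v'0 p'0 v0J p0J; congr (_ + _); apply: eq_cintegral => x.
    rewrite /= in_itv/= => /andP[x0 xa]; rewrite /alpha /beta !coefJ//.
    by rewrite !subrr !mul0r.
  have D := det_M mt0 a_ge0 (lexx a).
  have E1 := W _ _ s1; have E2 := W _ _ s2.
  rewrite -[LHS]mulr1 -[RHS]mulr1 -D.
  set A := conjc (v _ _) in E1 E2 *; set P := conjc (p _ _) in E1 E2.
  transitivity ((A * P2 (- t)%:C a - P * V2 (- t)%:C a) * V1 (- t)%:C a -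
    (A * P1 (- t)%:C a - P * V1 (- t)%:C a) * V2 (- t)%:C a); first by ring.
  by rewrite E1 E2; ring.
have E1 := uniq _ _ _ _ sol1 (conjc1 _) (conjc0 _).
have E2 := uniq _ _ _ _ sol2 (conjc0 _) (conjc1 _).
rewrite -ReJ; congr (Re _); rewrite /g /den -[M a (- t)%:C 0 0]E1 -[M a (- t)%:C 0 1]E2.
rewrite !(rmorphM, rmorphB, rmorphN, fmorphV)/= !conjcK.
by rewrite !oppr0.
Qed.

(** The condition v(a) = 0 is linear in r, with the nonvanishing denominator as coefficient. It has
    exactly one solution, so [xget] does not fall back on its default. *)
Lemma reflection_coefficientE (w : R) :
  1 - reflection_coefficient rho C a M w = g w%:C.
Proof.
have w0 : 0 <= Im w%:C by [].
have D0 := den_neq0 w0; have zC0 : z%:C != 0 :> R[i] by rewrite fmorph_eq0 gt_eqF.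
have M0 : [/\ V1 w%:C 0 = 1, P1 w%:C 0 = 0, V2 w%:C 0 = 0 & P2 w%:C 0 = 1].
  by have [_ ? ?] := sol1 w0; have [_ ? ?] := sol2 w0.
have e0 (k : R) : expi (k * 0) = 1 :> R[i] by rewrite mulr0 /expi cos0 sin0.
have e0N (k : R) : expi (- (k * 0)) = 1 :> R[i] by rewrite mulr0 oppr0 /expi cos0 sin0.
rewrite -[RHS](subKr 1) one_sub_g//; congr (_ - _).
set r0 := (_ / _); apply: xget_unique.
  pose p0 := 1 + r0; pose v0 := (1 - r0) / z%:C.
  exists (fun x => V1 w%:C x * v0 + V2 w%:C x * p0), (fun x => P1 w%:C x * v0 + P2 w%:C x * p0).
  have [-> -> -> ->] := M0.
  have E : (fun x => V1 w%:C x * v0 + V2 w%:C x * p0) 0 = v0.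
    by have [+ _ + _] := M0 => /= -> ->; rewrite mul1r mul0r addr0.
  split.
  - move=> x _; rewrite !mul1r !mul0r addr0 add0r; split; by [].
  - by rewrite /exterior_pressure e0 e0N mul0r mul1r add0r mulr1.
  - by rewrite /exterior_velocity e0 e0N mul1r mul0r addr0 mulr1.
  - rewrite /v0 /p0 /r0; move: D0; rewrite /den /V1 /V2 => D0.
    field; by rewrite D0.
move=> r [v [p [vp p0 v0 va]]].
have aI : a \in `[0, a] by rewrite in_itv/= a_ge0 lexx.
have [] := vp a aI; rewrite va p0 v0 /exterior_pressure /exterior_velocity e0 e0N !mulr1.
move=> E _; rewrite /r0.
apply: (mulIf D0); rewrite divfK//.
have : z%:C * 0 = z%:C * (M a w%:C 0 0 * ((1 - r) / z%:C) + M a w%:C 0 1 * (1 + r)) by rewrite -E.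
rewrite mulr0 => {}E; rewrite -[LHS]addr0 [X in _ + X]E /den /V1 /V2.
by field.
Qed.

End Reflection.

(** * The sum rule from Poisson's formula *)

Section SumRule.
Context {R : realType}.
Local Notation mu := (@lebesgue_measure R).

(* By Poisson's formula the integral of [Re g(t) / (t^2 + y^2)] over the line is
   [pi Re g(iy) / y]; let [y] tend to 0. *)
Lemma herglotz_sum_rule (g : R[i] -> R[i]) (B l : R) : bounded_holomorphic g B ->
  (forall t : R, 0 <= Re (g t%:C)) ->
  (forall t : R, Re (g (- t)%:C) = Re (g t%:C)) ->
  (fun n => n.+1%:R * Re (g (0 +i* n.+1%:R^-1))) @ \oo --> l ->
  (\int[mu]_(t in `]0%R, +oo[) (Re (g t%:C) / t ^+ 2)%R%:E = (pi / 2 * l)%:E)%E.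
Proof.
move=> gB g0 gE gl; pose G (t : R) := Re (g t%:C).
have Gc : continuous G.
  move=> t; apply: seq_continuous => u ut.
  have u0 n : 0 <= Im (u n)%:C by [].
  by have [] := bounded_holo_boundary gB u0 (ccvg_real ut).
have kc y : 0 < y -> continuous (fun t => G t * poisson_kernel 0 y t).
  by move=> y0 t; apply: cvgM; [exact: Gc|exact: continuous_poisson_kernel].
have km y (D : set R) : 0 < y -> measurable_fun D (fun t => (G t * poisson_kernel 0 y t)%:E).
  move=> y0; apply/measurable_EFinP; apply: measurable_funTS.
  by apply: continuous_measurable_fun; exact: kc.
have half y : 0 < y -> (\int[mu]_(t in `]0%R, +oo[) (G t * poisson_kernel 0 y t)%:E =
    (pi / 2 * Re (g (0 +i* y)))%:E)%E.
  move=> y0; have [ik _] := boundary_kernel_integrable gB 0 y0.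
  have full : (\int[mu]_t (G t * poisson_kernel 0 y t)%:E = (pi * Re (g (0 +i* y)))%:E)%E.
    have P : \int[mu]_t Re (g t%:C * (poisson_kernel 0 y t)%:C) = pi * Re (g (0 +i* y)).
      have := congr1 (@complex.Re R) (poisson_formula gB 0 y0).
      by rewrite ReM [Re pi%:C]/= [Im pi%:C]/= mul0r subr0.
    rewrite -P /Rintegral fineK.
      by apply: eq_integral => t _; rewrite ReM mulr0 subr0.
    exact: (integrable_fin_num _ ik).
  have := full; rewrite ge0_symfun_integralT; last 3 first.
  - by move=> t; rewrite mulr_ge0 ?g0// poisson_kernel_ge0.
  - exact: kc.
  - by move=> t /=; rewrite /G gE /poisson_kernel !subr0 sqrrN.
  rewrite -set_itvcy -integral_itv_obnd_cbnd; last exact: km.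
  set X := (\int[mu]_(_ in _) _)%E => X2.
  (* [X] is an extended real; twice it is finite, which rules out the infinite cases. *)
  case: X X2 => [r|/eqP|/eqP]; last 2 first.
  - by rewrite mulry gtr0_sg// mul1e.
  - by rewrite mulrNy gtr0_sg// mul1e.
  rewrite -EFinM => -[E]; congr EFin; apply: (@mulfI _ (2 : R)) => //.
  by rewrite E; field.
(* The factor n + 1 turns the kernel at y = 1 / (n + 1) into 1 / (t^2 + y^2), which increases with
   [n]. *)
pose h n (t : R) := (G t / (t ^+ 2 + n.+1%:R^-1 ^+ 2))%:E.
have hE n t : h n t = (n.+1%:R * (G t * poisson_kernel 0 n.+1%:R^-1 t))%:E.
  rewrite /h /poisson_kernel subr0; congr EFin.
  have d0 : t ^+ 2 + n.+1%:R^-1 ^+ 2 != 0 :> R.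
    by rewrite gt_eqF// ltr_wpDl ?sqr_ge0// exprn_gt0// invr_gt0 ltr0n.
  have n0 : n.+1%:R != 0 :> R by rewrite pnatr_eq0.
  have E (N d : R) : N != 0 -> d != 0 -> G t / d = N * (G t * (N^-1 / d)).
    by move=> N0 e0; field; rewrite N0 e0.
  exact: E.
have inv_gt0 n : 0 < n.+1%:R^-1 :> R by rewrite invr_gt0 ltr0n.
have hm n (D : set R) : measurable_fun D (h n).
  rewrite (_ : h n = fun t => (n.+1%:R%:E * (G t * poisson_kernel 0 n.+1%:R^-1 t)%:E)%E).
    by apply: measurable_funeM; exact: km.
  by apply/funext => t; rewrite hE EFinM.
have h0 n t : (0 <= h n t)%E.
  by rewrite lee_fin divr_ge0 ?g0// addr_ge0 ?sqr_ge0.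
have hI n : (\int[mu]_(t in `]0%R, +oo[) h n t =
    (n.+1%:R * (pi / 2 * Re (g (0 +i* n.+1%:R^-1))))%:E)%E.
  under eq_integral do rewrite hE EFinM.
  rewrite ge0_integralZl//; first by rewrite half.
  - exact: km.
  - by move=> t _; rewrite lee_fin mulr_ge0 ?g0// poisson_kernel_ge0.
have hnd t : {homo h^~ t : m n / (m <= n)%N >-> (m <= n)%E}.
  move=> m n mn; rewrite lee_fin ler_wpM2l ?g0//.
  have den n' : 0 < t ^+ 2 + n'.+1%:R^-1 ^+ 2 :> R.
    by rewrite ltr_wpDl ?sqr_ge0// exprn_gt0.
  rewrite lef_pV2 ?posrE// lerD2l ler_pXn2r ?nnegrE ?(ltW (inv_gt0 _))//.
  by rewrite lef_pV2 ?posrE ?ltr0n// ler_nat.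
have lim1 : (fun n => \int[mu]_(t in `]0%R, +oo[) h n t)%E @ \oo --> (pi / 2 * l)%:E.
  under eq_fun do rewrite hI.
  apply: cvg_EFin; first exact: nearW.
  under eq_fun do rewrite /= mulrCA.
  by apply: cvgM => //; exact: cvg_cst.
have lim2 : (fun n => \int[mu]_(t in `]0%R, +oo[) h n t)%E @ \oo -->
    (\int[mu]_(t in `]0%R, +oo[) limn (h^~ t))%E.
  by apply: cvg_monotone_convergence => // n; exact: hm.
rewrite (cvg_unique _ lim1 lim2)//.
(* The half-line excludes 0, so the limit of the denominators is nonzero. *)
apply: eq_integral => t; rewrite inE/= in_itv/= andbT => t0.
apply/esym/cvg_lim => //; apply: cvg_EFin; first exact: nearW.
apply: cvgM; first exact: cvg_cst.
apply: cvgV; first by rewrite expf_neq0// gt_eqF.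
rewrite -[X in _ --> X]addr0; apply: cvgD; first exact: cvg_cst.
under eq_fun do rewrite expr2.
have H : (fun n => n.+1%:R^-1 * n.+1%:R^-1) @ \oo --> (0 * 0 : R).
  by apply: cvgM; exact: cvg_harmonic.
by rewrite mulr0 in H.
Qed.

End SumRule.

Theorem mainTheorem4 (R : realType) (rho C a : R)
    (rho_gt0 : 0 < rho) (C_gt0 : 0 < C) (a_gt0 : 0 < a)
    (rho' C' : R -> R[i] -> R[i])
    (rho'_slab : slab_property a rho') (C'_slab : slab_property a C')
    (M : R -> R[i] -> 'M[R[i]]_2)
    (M_propagator : forall w : R[i], 0 <= complex.Im w ->
       is_propagator a rho' C' w (fun x => M x w)) :
  (\int[lebesgue_measure]_(w in `]0%R, +oo[)
     (complex.Re (1 - reflection_coefficient rho C a M w) / w ^+ 2)%R%:E)%E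
  = (pi * a / sound_speed rho C
       * (average a (fun x => complex.Re (C' x 0)) / C))%:E.
Proof.
under eq_integral do
  rewrite (reflection_coefficientE rho_gt0 C_gt0 a_gt0 rho'_slab C'_slab M_propagator).
rewrite (herglotz_sum_rule
  (reflection_defect_holomorphic rho_gt0 C_gt0 a_gt0 rho'_slab C'_slab M_propagator) _ _
  (reflection_defect_low_frequency a_gt0 rho'_slab C'_slab M_propagator)).
- congr EFin; rewrite /average /sound_speed /impedance invrK.
  (* This is z = 1 / (c C), which turns pi z into the constant of the statement. *)
  have -> : Num.sqrt (C * rho) = C * Num.sqrt (rho / C).
    have -> : C * rho = C ^+ 2 * (rho / C) by field; rewrite gt_eqF.
    by rewrite sqrtrM ?sqr_ge0// sqrtr_sqr ger0_norm// ltW.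
  move: (Num.sqrt _) (Rintegral _ _ _) => s I; field; by rewrite !gt_eqF.
- move=> t.
  exact: (reflection_defect_Re_ge0 rho_gt0 C_gt0 a_gt0 rho'_slab C'_slab M_propagator).
- exact: (reflection_defect_even rho C a_gt0 rho'_slab C'_slab M_propagator).
Qed.
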